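(* There exist an absolute constant $\kappa>0$ and an infinite sequence of concept classes $\mathcal C_k\subseteq\{0,1\}^{N_k}$ ($k=1,2,3,\dots$) with $\mathsf Q(\mathcal C_k)\ge 2$ for all $k$ such that $\mathsf Q(\mathcal C_k)\to\infty$ as $k\to\infty$ and, for every $k$, $$\mathsf R(\mathcal C_k)\;\ge\;\kappa\,\frac{\mathsf Q(\mathcal C_k)^3}{\log \mathsf Q(\mathcal C_k)}\,\log N_k .$$
   Context: A concept class is a set $\mathcal C\subseteq\{0,1\}^N$; its elements (concepts) are viewed as functions $c:[N]\to\{0,1\}$, and $[N]$ may be identified with any finite set of size $N$. Exact learning with membership queries: an unknown target $c^*\in\mathcal C$ is accessed by queries, and the learner must output $c^*$. A classical query at $i\in[N]$ returns $c^*_i$; queries may be adaptive. $\mathsf R(\mathcal C)$ is the minimum worst-case number of queries of a randomized learner that, for every $c^*\in\mathcal C$, outputs $c^*$ with probability at least $2/3$. $\mathsf Q(\mathcal C)$ is the bounded-error quantum query complexity: the minimum number of applications of the unitary $|i,b\rangle\mapsto|i,b\oplus c^*_i\rangle$ (interleaved with arbitrary target-independent unitaries, followed by a measurement) needed by a quantum algorithm that outputs $c^*$ with probability at least $2/3$ for every $c^*\in\mathcal C$. Logarithms are base 2. *)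

(* Defs.v *)
From HB Require Import structures.
From mathcomp Require Import all_boot all_order all_algebra.
From mathcomp Require Import all_classical all_reals all_analysis.
From mathcomp Require Import spectral complex.

Set Implicit Arguments.
Unset Strict Implicit.
Unset Printing Implicit Defensive.

Import Order.TTheory GRing.Theory Num.Theory.

Local Open Scope classical_set_scope.
Local Open Scope ring_scope.

Definition concept (N : nat) : finType := {ffun 'I_N -> bool}.

Definition concept_class (N : nat) : Type := {set concept N}.

(* If no [n] satisfies [P], the value is 0. The two query complexities below
   never use this default when [0 < N], since querying every coordinate
   identifies the target; when [N = 0] the correct value is 0 anyway. *)
Definition least (P : nat -> Prop) : nat :=
  xget 0%N [set n | P n /\ forall m, P m -> (n <= m)%N].

Definition log2 {R : realType} (x : R) : R := ln x / ln 2.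

Section RandomizedLearning.
Variable N : nat.

(* Deterministic adaptive learners; the subtree followed after a query is
   selected by the bit that the query returns. *)
Inductive decision_tree : Type :=
  | Output (h : concept N)
  | Query (i : 'I_N) (next : bool -> decision_tree).

Fixpoint run (t : decision_tree) (c : concept N) : concept N :=
  match t with
  | Output h => h
  | Query i next => run (next (c i)) c
  end.

Fixpoint depth (t : decision_tree) : nat :=
  match t with
  | Output _ => 0%N
  | Query _ next => (maxn (depth (next false)) (depth (next true))).+1
  end.

(* A [T]-query randomized learner draws a seed [s] with probability [p s] and
   runs the deterministic learner [t s]. Finitely many seeds are enough, as
   there are finitely many decision trees of depth at most [T]. *)
Definition randomized_learnable (R : realType) (C : concept_class N) (T : nat)
    : Prop :=
  exists (m : nat) (p : 'I_m -> R) (t : 'I_m -> decision_tree),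
    [/\ forall s, 0 <= p s,
        \sum_s p s = 1,
        forall s, (depth (t s) <= T)%N
      & forall c, c \in C -> 2 / 3 <= \sum_(s | run (t s) c == c) p s].

Definition randomized_query_complexity (R : realType) (C : concept_class N)
    : nat :=
  least (randomized_learnable R C).

End RandomizedLearning.

Section QuantumLearning.
Variables (R : realType) (N : nat).

(* The computational basis |i, b, z> of the query register, the answer
   register and a workspace of dimension [w]. *)
Definition qbasis (w : nat) : finType := ('I_N * bool * 'I_w)%type.

Definition qstate (w : nat) : Type := 'cV[R[i]]_#|qbasis w|.

Definition qoperator (w : nat) : Type := 'M[R[i]]_#|qbasis w|.

Definition query_basis (w : nat) (c : concept N) (x : qbasis w) : qbasis w :=
  let: (i, b, z) := x in (i, b (+) c i, z).

Definition query_mx (w : nat) (c : concept N) : qoperator w :=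
  \matrix_(x, y) (enum_val x == query_basis c (enum_val y))%:R.

(* The probability that a computational-basis measurement of [psi] yields a
   basis label in [A]. It is a real number, here as an element of R[i], on
   which [<=] requires both sides to have the same imaginary part. *)
Definition measure_prob (w : nat) (psi : qstate w) (A : pred (qbasis w))
    : R[i] :=
  \sum_(x | A x) `|psi (enum_rank x) 0| ^+ 2.

(* The state U_T O_c U_(T-1) ... U_1 O_c U_0 psi. *)
Fixpoint final_state (w : nat) (U : nat -> qoperator w) (c : concept N)
    (psi : qstate w) (T : nat) : qstate w :=
  match T with
  | 0 => U 0%N *m psi
  | T'.+1 => U T'.+1 *m (query_mx w c *m final_state U c psi T')
  end.

(* Only U_0, ..., U_T are used. The final measurement is in the computational
   basis, with the label then mapped to a hypothesis by [out]; any other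
   measurement is absorbed into U_T, since [w] is arbitrary. *)
Definition quantum_learnable (C : concept_class N) (T : nat) : Prop :=
  exists (w : nat) (psi : qstate w) (U : nat -> qoperator w)
      (out : qbasis w -> concept N),
    [/\ measure_prob psi predT = 1,
        forall t, U t \is unitarymx
      & forall c, c \in C ->
          2 / 3 <= measure_prob (final_state U c psi T) [pred x | out x == c]].

Definition quantum_query_complexity (C : concept_class N) : nat :=
  least (quantum_learnable C).

End QuantumLearning.

Arguments quantum_query_complexity R {N} C.
Arguments randomized_query_complexity {N} R C.

(* Main.v *)
(* Concepts are indexed by a key [k] in a field [F] of characteristic two and a
   monic polynomial [phi] over [F] of degree [D], where [#|F| = D ^ 8]. A first
   table marks, for each [(x, y)], the cell [pi (phi (y + k x))] among [D ^ 2]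
   cells, with [pi] a balanced map. A second table, readable only at the key
   [k], holds the Walsh-Hadamard codewords of the coefficients of [phi].

   A quantum learner finds the marked cells in superposition by exact Grover
   search ([D] queries). The result is constant on the lines [y + k x = const],
   so one Fourier transform reveals [k], as in Simon's algorithm; one
   Bernstein-Vazirani query per coefficient then yields [phi].

   A classical learner must find about [D] marked cells, at a cost of order
   [D ^ 2] each. Before that, the cells behave like those of a uniformly random
   function ([D]-wise independence and truncated inclusion-exclusion), so that
   [k] is found neither by querying the second table at the right key nor by a
   collision, and fewer than [D] positive answers cannot determine [phi]. Thus
   R is of order [D ^ 3], while Q = O(D) and [N] is polynomial in [D].

   The lower bound Q >= D / 5 comes from counting: the final states lie in the
   span of [(2 N) ^ T] vectors that do not depend on the concept. *)
Require Import Defs.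
From mathcomp Require Import all_boot all_order all_algebra all_field.
From mathcomp Require Import all_classical all_reals all_analysis.
From mathcomp Require Import perm spectral complex zify ring lra.

Set Implicit Arguments.
Unset Strict Implicit.
Unset Printing Implicit Defensive.

Import Order.TTheory GRing.Theory Num.Theory.
Import numFieldNormedType.Exports.

Local Open Scope ring_scope.

(** * Sampling with limited independence *)

(** The bit is the absolute trace [tr]. Squaring permutes its summands cyclically, so its values are
    0 and 1; a polynomial of degree [2 ^ n] cannot vanish on all [2 ^ n.+1] elements of the
    field. *)
Lemma exists_additive_bit (F : finFieldType) (n : nat) :
  2%N \in [pchar F] -> #|F| = (2 ^ n.+1)%N ->
  exists lam : F -> bool,
    {morph lam : x y / x + y >-> x (+) y} /\ exists x, lam x.
Proof.
move=> ch2 cardF.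
pose tr (x : F) : F := \sum_(i < n.+1) x ^+ (2 ^ i).
have sqrD (x y : F) : (x + y) ^+ 2 = x ^+ 2 + y ^+ 2.
  by rewrite sqrrD mulr2n addrr_pchar2 // addr0.
have powD i (x y : F) : (x + y) ^+ (2 ^ i) = x ^+ (2 ^ i) + y ^+ (2 ^ i).
  by elim: i => [|i IH]; rewrite ?expr1 // expnSr !exprM IH sqrD.
have trD x y : tr (x + y) = tr x + tr y.
  by rewrite /tr -big_split /=; apply: eq_bigr => i _; exact: powD.
have sqr_sum m (f : nat -> F) : (\sum_(i < m) f i) ^+ 2 = \sum_(i < m) f i ^+ 2.
  by elim: m => [|m IH]; rewrite ?big_ord0 ?expr0n // !big_ord_recr /= sqrD IH.
have tr_idem x : tr x ^+ 2 = tr x.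
  rewrite /tr (sqr_sum _ (fun i => x ^+ (2 ^ i))) big_ord_recr /= -exprM -expnSr.
  rewrite -cardF expf_card big_ord_recl expn0 expr1 addrC; congr (_ + _).
  by apply: eq_bigr => i _; rewrite -exprM -expnSr.
have tr01 x : tr x = 0 \/ tr x = 1.
  have /eqP := tr_idem x; rewrite -subr_eq0 expr2 -[X in _ - X]mulr1 -mulrBr.
  by rewrite mulf_eq0 subr_eq0 => /orP[] /eqP; [left|right].
exists (fun x => tr x != 0); split.
  move=> x y; rewrite trD.
  case: (tr01 x) (tr01 y) => -> [] ->; rewrite ?addr0 ?add0r ?eqxx ?oner_eq0 //.
  by rewrite addrr_pchar2 // eqxx.
apply/existsP; apply: contraT; rewrite negb_exists => /forallP tr0.
pose p : {poly F} := \sum_(i < n.+1) 'X^(2 ^ i).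
have size_lo : (size (\sum_(i < n) 'X^(2 ^ i) : {poly F})%R < (2 ^ n).+1)%N.
  rewrite ltnS; apply: (leq_trans (size_sum _ _ _)); apply/bigmax_leqP => i _.
  by rewrite size_polyXn ltn_exp2l.
have size_p : size p = (2 ^ n).+1.
  by rewrite /p big_ord_recr /= addrC size_polyDl size_polyXn.
have p_neq0 : p != 0 by rewrite -size_poly_eq0 size_p.
suff roots_p : all (root p) (enum F).
  have := max_poly_roots p_neq0 roots_p (enum_uniq F).
  by rewrite -cardT size_p cardF ltnS leqNgt ltn_exp2l // ltnSn.
apply/allP => x _; rewrite rootE /p horner_sum.
rewrite (eq_bigr (fun i : 'I__ => x ^+ (2 ^ i))) => [|i _]; last by rewrite hornerXn.
by have := tr0 x; rewrite negbK.
Qed.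

Section Sampling.
Variables (R : realFieldType) (P W : eqType).

(** [L] lists the positive answers of a transcript, [M] the negative ones; [O] is a uniform sample
    space. *)
Definition freq (O : finType) (val : O -> P -> W) (L M : seq (P * W)) : R :=
  #|[set o | all (fun c => val o c.1 == c.2) L
             && all (fun c => val o c.1 != c.2) M]|%:R / #|O|%:R.

Variables (O : finType) (val : O -> P -> W).

Lemma freq_ge0 L M : 0 <= freq val L M.
Proof. by rewrite divr_ge0. Qed.

Lemma freq_split c L M : freq val L M = freq val (c :: L) M + freq val L (c :: M).
Proof.
rewrite /freq -mulrDl -natrD; congr (_%:R / _).
rewrite -(cardsID [set o | val o c.1 == c.2]); congr (_ + _)%N; apply: eq_card.
  by move=> o; rewrite !inE /=; case: (val o c.1 == c.2); rewrite /= ?andbF ?andbT.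
by move=> o; rewrite !inE /=; case: (val o c.1 == c.2); rewrite /= ?andbF ?andbT.
Qed.

Lemma freq_cons_le c L M : freq val L (c :: M) <= freq val L M.
Proof. by rewrite [leRHS](freq_split c) lerDr freq_ge0. Qed.

Lemma freq_le L M : freq val L M <= freq val L [::].
Proof. by elim: M => // c M; apply: le_trans (freq_cons_le _ _ _). Qed.

Lemma freq_cons_in c L M : c \in L -> freq val (c :: L) M = freq val L M.
Proof.
move=> cL; rewrite /freq; congr (_%:R / _); apply: eq_card => o; rewrite !inE /=.
by case: (boolP (all _ L)) => [/allP/(_ _ cL)/= ->|]; rewrite ?andbF.
Qed.

Lemma freq_cons_notin p w w' L M :
  (p, w') \in L -> w != w' -> freq val ((p, w) :: L) M = 0.
Proof.
move=> pL ww'; rewrite /freq eq_card0 ?mul0r // => o; rewrite !inE /=.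
apply/negP => /andP[/andP[/eqP vw /allP/(_ _ pL)/= vw'] _].
by move: ww'; rewrite -vw vw'.
Qed.

(** The restriction to [X] is there because the cells of a random polynomial are independent only at
    points on distinct lines. *)
Definition independent (s : R) (D : nat) (X : {pred P}) : Prop :=
  forall L, uniq (unzip1 L) -> (size L <= D)%N -> {subset unzip1 L <= X} ->
    freq val L [::] = s^-1 ^+ size L.

End Sampling.

(* Inclusion-exclusion, cut off at [D] positive constraints. *)
Lemma freq_close (R : realFieldType) (P W : eqType) (s : R) (D : nat)
    (X : {pred P}) (O1 O2 : finType)
    (val1 : O1 -> P -> W) (val2 : O2 -> P -> W) :
  0 <= s ->
  independent val1 s D X -> independent val2 s D X ->
  forall M L, uniq (unzip1 L) -> (size L <= D)%N ->
    {subset unzip1 (L ++ M) <= X} ->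
  `|freq R val1 L M - freq R val2 L M| <= 'C(size M, D - size L)%:R * s^-1 ^+ D.
Proof.
move=> s_ge0 ind1 ind2; have sD_ge0 : 0 <= s^-1 ^+ D by rewrite exprn_ge0 ?invr_ge0.
elim=> [|[p w] M IH] L uL szL subX.
  rewrite cats0 in subX; rewrite ind1 ?ind2 // subrr normr0.
  by rewrite mulr_ge0.
have subL : {subset unzip1 L <= X}.
  by move=> z zL; apply: subX; rewrite /unzip1 map_cat mem_cat zL.
have subLM : {subset unzip1 (L ++ M) <= X}.
  move=> z; rewrite /unzip1 map_cat mem_cat => zLM; apply: subX.
  by rewrite /unzip1 map_cat mem_cat /= inE orbCA zLM orbT.
have pX : p \in X by apply: subX; rewrite /unzip1 map_cat mem_cat inE eqxx orbT.
have split_eq (O : finType) (val : O -> P -> W) :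
    freq R val L ((p, w) :: M) = freq R val L M - freq R val ((p, w) :: L) M.
  by rewrite (freq_split R val (p, w) L M) addrC addKr.
(* The expansion stops here: with [D] positive constraints both frequencies lie between 0 and
   [s^-1 ^+ D]. *)
have [szD|szD] := eqVneq (size L) D.
  rewrite szD subnn bin0 mul1r.
  have fle (O : finType) (val : O -> P -> W) M' : independent val s D X -> 
      0 <= freq R val L M' <= s^-1 ^+ D.
    by move=> ind; rewrite freq_ge0 (le_trans (freq_le _ _ _ _)) // ind // szD.
  have /andP[? ?] := fle _ _ ((p, w) :: M) ind1.
  have /andP[? ?] := fle _ _ ((p, w) :: M) ind2.
  by rewrite ler_norml; apply/andP; split; lra.
have {}szD : (size L < D)%N by rewrite ltn_neqAle szD.
have [d dE] : exists d, (D - size L = d.+1)%N by exists (D - size L).-1; lia.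
have IHL := IH L uL szL subLM; rewrite dE in IHL *.
have mono : 'C(size M, d.+1)%:R * s^-1 ^+ D
    <= 'C(size ((p, w) :: M), d.+1)%:R * s^-1 ^+ D.
  by rewrite ler_wpM2r // ler_nat /= binS leq_addr.
have [/mapP[[p' w'] /= pwL pp']|pL] := boolP (p \in unzip1 L).
  subst p'; apply: le_trans mono; rewrite !split_eq.
  have [ww'|ww'] := eqVneq w w'.
    by subst w'; rewrite !freq_cons_in // !subrr normr0 mulr_ge0.
  by rewrite !(freq_cons_notin _ _ _ pwL) // !subr0.
rewrite !split_eq.
have -> (a b c e : R) : (a - b) - (c - e) = (a - c) - (b - e) by ring.
apply: le_trans (ler_normB _ _) _.
rewrite /= binS natrD mulrDl lerD //.
have -> : d = (D - size ((p, w) :: L))%N by rewrite /=; lia.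
apply: IH => //=; first by rewrite pL.
move=> z; rewrite inE => /predU1P[->//|]; exact: subLM.
Qed.

Lemma uniq_unzip1_inj (A B : eqType) (L : seq (A * B)) (c c' : A * B) :
  uniq (unzip1 L) -> c \in L -> c' \in L -> c.1 = c'.1 -> c = c'.
Proof.
move=> uL cL c'L cc'; rewrite -(nth_index c cL) -(nth_index c c'L).
have idx x : x \in L -> index x L = index x.1 (unzip1 L).
  move=> xL; rewrite -{2}(nth_index x xL) -(nth_map x x.1) ?index_mem //.
  by rewrite index_uniq // size_map index_mem.
by rewrite !idx // cc'.
Qed.

Lemma card_family_ratio (R : numFieldType) (A B : finType) (s : R)
    (S : {set A}) (F : A -> pred B) :
  (0 < #|B|)%N ->
  (forall x, x \in S -> #|F x|%:R / #|B|%:R = s^-1) ->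
  (forall x, x \notin S -> #|F x| = #|B|) ->
  #|family F|%:R / #|{ffun A -> B}|%:R = s^-1 ^+ #|S|.
Proof.
move=> B_gt0 FS FnS.
have B_neq0 : #|B|%:R != 0 :> R by rewrite pnatr_eq0 -lt0n.
have fam : #|family F| = (\prod_x #|F x|)%N by rewrite card_family foldrE big_map enumT.
have ffu : #|{ffun A -> B}| = (\prod_(x : A) #|B|)%N by rewrite card_ffun prod_nat_const.
rewrite fam ffu !natr_prod -prodf_div.
rewrite (bigID (mem S)) /= [X in _ * X]big1 => [|x xS]; last by rewrite FnS // divff.
by rewrite mulr1 (eq_bigr (fun _ => s^-1)) // prodr_const.
Qed.

(** The reference model of the adversary: its frequencies do not depend on the key. *)
Lemma independent_ffun (R : realFieldType) (P W : finType) (D : nat)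
    (X : {pred P}) :
  (0 < #|W|)%N ->
  independent (fun (g : {ffun P -> W}) p => g p) (#|W|%:R : R) D X.
Proof.
move=> W_gt0 L uL _ _.
have W_neq0 : #|W|%:R != 0 :> R by rewrite pnatr_eq0 -lt0n.
pose F p : pred W := fun w => all (fun c => (c.1 == p) ==> (w == c.2)) L.
have -> : size L = #|[set p in unzip1 L]|.
  by rewrite cardsE (card_uniqP uL) size_map.
rewrite -(card_family_ratio (F := F)) //.
- rewrite /freq; congr (_%:R / _); apply: eq_card => g; rewrite inE andbT.
  apply/allP/familyP => [gL p|gF [p w] cL].
    by apply/allP => -[p' w] cL; apply/implyP => /eqP/= <-; exact: gL cL.
  by have /allP/(_ _ cL)/= := gF p; rewrite eqxx.
- move=> p; rewrite inE => /mapP[[p' w] cL /= ->].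
  rewrite (_ : #|F p'| = 1%N) ?mul1r // -(card1 w); apply: eq_card => w'.
  rewrite /F unfold_in [RHS]inE /=; apply/allP/idP => [/(_ _ cL)/=|/eqP-> c c'L].
    by rewrite eqxx.
  by apply/implyP => /eqP cp; rewrite -(uniq_unzip1_inj uL cL c'L (esym cp)).
- move=> p; rewrite inE => pL; apply: eq_card => w; rewrite /F unfold_in [RHS]inE.
  apply/allP => c cL; apply/implyP => /eqP cp; move: pL.
  by rewrite -cp (map_f fst cL).
Qed.

(** * Limited independence of random monic polynomials *)

Section Polynomials.
Variables (F : finFieldType) (D : nat).

(** The leading coefficient is fixed so that, for positive [D], no value is taken more than [D]
    times. *)
Definition monic_eval (a : {ffun 'I_D -> F}) (z : F) : F :=
  z ^+ D + \sum_(j < D) a j * z ^+ j.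

Lemma monic_eval_roots (a : {ffun 'I_D -> F}) (u : F) :
  (0 < D)%N -> (#|[set z | monic_eval a z == u]| <= D)%N.
Proof.
move=> D_gt0.
pose f : {poly F} := 'X^D + (\poly_(j < D) oapp a 0 (insub j) - u%:P).
have size_f : size f = D.+1.
  rewrite size_polyDl size_polyXn // ltnS; apply: leq_trans (size_polyD _ _) _.
  by rewrite geq_max size_poly size_polyN (leq_trans (size_polyC_leq1 _)).
have horner_f z : f.[z] = monic_eval a z - u.
  rewrite !(hornerD, hornerN, hornerC, hornerXn) horner_poly addrA; congr (_ + _ - _).
  by apply: eq_bigr => j _; rewrite valK.
have f_neq0 : f != 0 by rewrite -size_poly_eq0 size_f.
rewrite cardE -ltnS -size_f; apply: max_poly_roots => //; last exact: enum_uniq.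
apply/allP => z; rewrite mem_enum inE => /eqP fz.
by rewrite rootE horner_f fz subrr.
Qed.

Lemma monic_eval_inj (zs : seq F) (a a' : {ffun 'I_D -> F}) :
  uniq zs -> size zs = D -> {in zs, monic_eval a =1 monic_eval a'} -> a = a'.
Proof.
move=> uz sz eqz.
pose g : {poly F} := \poly_(j < D) (oapp (fun i => a i - a' i) 0 (insub j)).
have horner_g z : g.[z] = monic_eval a z - monic_eval a' z.
  rewrite horner_poly /monic_eval opprD addrACA subrr add0r -sumrB; apply: eq_bigr => j _.
  by rewrite valK /= mulrBl.
have g0 : g = 0.
  apply: contraTeq (leqnn D) => g_neq0; rewrite -ltnNge -{1}sz.
  have size_g : (size g <= D)%N by exact: size_poly.
  apply: leq_trans size_g; apply: max_poly_roots => //.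
  by apply/allP => z zz; rewrite rootE horner_g eqz // subrr.
apply/ffunP => j; apply/eqP; rewrite -subr_eq0.
have := congr1 (fun p : {poly F} => p`_j) g0.
by rewrite /= coef_poly ltn_ord coef0 valK /= => ->.
Qed.

(** By interpolation, evaluation at [D] distinct points is a bijection from coefficient vectors to
    [D]-tuples of values, so the values are independent and uniform; [pi_bal] carries this over to
    cells. *)
Lemma independent_monic_eval (R : realFieldType) (W : finType) (P : eqType)
    (pi : F -> W) (line : P -> F) (s : R) (X : {pred P}) :
  (D <= #|F|)%N ->
  (forall w, #|[set v | pi v == w]|%:R / #|F|%:R = s^-1) ->
  {in X &, injective line} ->
  independent (fun a p => pi (monic_eval a (line p))) s D X.
Proof.
move=> DF pi_bal line_inj L uL sL LX.
have [L0|[p0 _]] : unzip1 L = [::] \/ exists p0, p0 \in unzip1 L.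
- by case: (unzip1 L) => [|p l]; [left|right; exists p; rewrite inE eqxx].
- have -> : L = [::] by case: (L) L0.
  rewrite /freq expr0 /= (eq_card (B := predT)) => [|a]; last by rewrite !inE.
  by rewrite divff // pnatr_eq0 -lt0n; apply/card_gt0P; exists 0.
pose zs := map line (unzip1 L).
have uzs : uniq zs.
  by rewrite map_inj_in_uniq // => p p' pL p'L; apply: line_inj; exact: LX.
(* Pad the points to exactly [D], so that [ev] is a bijection; the constraints concern its first
   [size L] coordinates. *)
pose Z := take D (zs ++ [seq z <- enum F | z \notin zs]).
have sZ : size Z = D.
  rewrite size_take_min; apply/minn_idPl; apply: leq_trans DF _.
  rewrite cardE; apply: uniq_leq_size (enum_uniq _) _ => z _.
  by rewrite mem_cat mem_filter mem_enum andbT; case: (z \in zs).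
have uZ : uniq Z.
  apply: take_uniq; rewrite cat_uniq uzs filter_uniq ?enum_uniq // andbT /=.
  by apply/hasPn => z; rewrite mem_filter => /andP[].
pose ev (a : {ffun 'I_D -> F}) : {ffun 'I_D -> F} := [ffun i : 'I_D => monic_eval a Z`_i].
have ev_inj : injective ev.
  move=> a a' /ffunP evE; apply: (monic_eval_inj uZ sZ) => z /(nthP 0) -[j].
  by rewrite sZ => jD <-; have := evE (Ordinal jD); rewrite !ffunE.
pose c0 j := nth (pi 0) (unzip2 L) j.
pose G (i : 'I_D) : pred F := fun v => (i < size L)%N ==> (pi v == c0 i).
have -> : size L = #|[set i : 'I_D | (i < size L)%N]|.
  have widen_inj : injective (widen_ord sL) by move=> j j' [/val_inj].
  rewrite -{1}[size L]card_ord -(card_imset _ widen_inj); apply: eq_card => j.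
  rewrite [RHS]inE; apply/imsetP/idP => [[j' _ ->]|jL].
    exact: (ltn_ord j').
  by exists (Ordinal jL) => //; apply: val_inj.
have F_gt0 : (0 < #|F|)%N by apply/card_gt0P; exists 0.
rewrite -(card_family_ratio (F := G)) //.
- rewrite /freq; congr (_%:R / _).
  rewrite -(on_card_preimset (onW_bij (family G) (injF_bij ev_inj))).
  apply: eq_card => a; rewrite inE andbT [RHS]inE.
  have ev_nth (i : nat) (iL : (i < size L)%N) (iD : (i < D)%N) :
      ev a (Ordinal iD) = monic_eval a (line (nth (p0, pi 0) L i).1).
    rewrite ffunE /= nth_take // nth_cat !size_map iL.
    by rewrite (nth_map p0) ?size_map // (nth_map (p0, pi 0)).
  apply/allP/familyP => [aL i|aG c /(nthP (p0, pi 0)) -[i iL <-]].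
    rewrite /G unfold_in; apply/implyP => iL; case: i iL => i iD /= iL.
    rewrite (ev_nth i iL) /c0 (nth_map (p0, pi 0)) //.
    by apply: aL; exact: mem_nth.
  have iD := leq_trans iL sL.
  have := aG (Ordinal iD); rewrite /G unfold_in /= iL /= (ev_nth i iL).
  by rewrite /c0 (nth_map (p0, pi 0)).
- move=> i; rewrite inE => iL; rewrite -(pi_bal (c0 i)); congr (_%:R / _).
  by apply: eq_card => v; rewrite [RHS]inE /G unfold_in iL.
- move=> i; rewrite inE => iL; apply: eq_card => v.
  by rewrite /G unfold_in (negPf iL).
Qed.

End Polynomials.

(** * The concept class *)

Section HiddenClass.
Variables (F : finFieldType) (W : finType) (lam : F -> bool) (pi : F -> W) (D : nat).

Definition position : finType := (F * F * W + F * 'I_D * F)%type.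

Definition line (k : F) (p : F * F) : F := p.2 + k * p.1.

Definition hidden_bit (k : F) (a : {ffun 'I_D -> F}) (x : position) : bool :=
  match x with
  | inl (p, w) => pi (monic_eval a (line k p)) == w
  | inr (k', j, z) => (k' == k) && lam (z * a j)
  end.

Definition hidden_concept (k : F) (a : {ffun 'I_D -> F}) : concept #|position| :=
  [ffun i => hidden_bit k a (enum_val i)].

Definition hidden_class : concept_class #|position| :=
  [set hidden_concept ka.1 ka.2 | ka : F * {ffun 'I_D -> F}].

Hypothesis lamD : {morph lam : x y / x + y >-> x (+) y}.
Hypothesis lam_neq0 : exists x, lam x.

Lemma lam0 : lam 0 = false.
Proof. by have := lamD 0 0; rewrite addr0 addbb. Qed.

Lemma lamN x : lam (- x) = lam x.
Proof. by have := lamD x (- x); rewrite subrr lam0; do 2!case: (lam _). Qed.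

(** Nondegeneracy of the form [lam (z * a)]: a nonzero [a - b] can be scaled to any [x] with
    [lam x]. *)
Lemma lam_mul_inj (a b : F) : (forall z, lam (z * a) = lam (z * b)) -> a = b.
Proof.
move=> eq_ab; apply/eqP; rewrite -subr_eq0; apply: contraT => ab.
have [x] := lam_neq0; rewrite -[x](divfK ab) mulrBr lamD -mulrN mulrN lamN.
by rewrite eq_ab addbb.
Qed.

Lemma hidden_concept_inj k : injective (hidden_concept k).
Proof.
move=> a b /ffunP eq_ab; apply/ffunP => j; apply: lam_mul_inj => z.
by have := eq_ab (enum_rank (inr (k, j, z) : position)); rewrite !ffunE enum_rankK /= eqxx.
Qed.

Lemma hidden_concept_in k a : hidden_concept k a \in hidden_class.
Proof. by apply/imsetP; exists (k, a). Qed.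

(** The only key that can put two distinct points on one line. Distinct points with equal first
    coordinates never share a line; for them division by zero gives a harmless 0. *)
Definition slope (p p' : F * F) : F := (p'.2 - p.2) / (p.1 - p'.1).

Lemma line_slope k p p' : p != p' -> line k p = line k p' -> k = slope p p'.
Proof.
case: p p' => [x y] [x' y']; rewrite /line /slope /= => pp' /eqP.
rewrite -subr_eq0 => /eqP eqp.
have xx' : x - x' != 0.
  rewrite subr_eq0; apply: contraNneq pp' => xx'; rewrite xx' in eqp *.
  by apply/eqP; congr pair; apply/eqP; rewrite -subr_eq0 -eqp; apply/eqP; ring.
apply: (mulIf xx'); rewrite divfK //; apply/eqP; rewrite -subr_eq0 -eqp.
by apply/eqP; ring.
Qed.

(** * Adversary bound for deterministic trees *)

Section Adversary.
Variable R : realFieldType.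
Hypothesis W_gt0 : (0 < #|W|)%N.
Hypothesis leWF : (#|W| <= #|F|)%N.
Hypothesis leDF : (D <= #|F|)%N.
Hypothesis pi_bal :
  forall w, #|[set v | pi v == w]|%:R / #|F|%:R = #|W|%:R^-1 :> R.

Notation s := (#|W|%:R : R).
Notation q := #|F|.
Notation concept := (concept #|position|).

Let val k (a : {ffun 'I_D -> F}) p := pi (monic_eval a (line k p)).

Let fr k L M := freq R (val k) L M.

Let nu L M := freq R (fun (g : {ffun F * F -> W}) p => g p) L M.

(** A joint frequency rather than a conditional one, so that the contributions of the two branches
    of a query add up. *)
Definition learned (t : decision_tree #|position|) (k : F) L M : R :=
  #|[set a | [&& all (fun c => val k a c.1 == c.2) L,
                 all (fun c => val k a c.1 != c.2) M
               & run t (hidden_concept k a) == hidden_concept k a]]|%:R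
  / #|{ffun 'I_D -> F}|%:R.

Lemma learned_le t k L M : learned t k L M <= fr k L M.
Proof.
rewrite /learned /fr /freq ler_wpM2r ?invr_ge0 // ler_nat.
by apply: subset_leq_card; apply/fintype.subsetP => a; rewrite !inE andbA => /andP[].
Qed.

Lemma learned_output h k L M : learned (Output h) k L M <= #|{ffun 'I_D -> F}|%:R^-1.
Proof.
rewrite /learned -[leRHS]mul1r ler_wpM2r ?invr_ge0 // lern1.
apply/card_le1_eqP => a b; rewrite !inE => /and3P[_ _ /eqP ha] /and3P[_ _ /eqP hb].
by apply: (@hidden_concept_inj k); rewrite -ha -hb.
Qed.

Lemma learned_point i next k p w L M : enum_val i = inl (p, w) ->
  learned (Query i next) k L M =
  learned (next true) k ((p, w) :: L) M + learned (next false) k L ((p, w) :: M).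
Proof.
move=> iE; rewrite /learned -mulrDl -natrD; congr (_%:R / _).
rewrite -(cardsID [set a | val k a p == w]); congr (_ + _)%N; apply: eq_card => a;
  rewrite !inE /= ffunE iE /= /val;
  by case: (pi _ == w); rewrite /= ?andbF ?andbT.
Qed.

Lemma learned_key i next k k' j z L M : enum_val i = inr (k', j, z) -> k' != k ->
  learned (Query i next) k L M = learned (next false) k L M.
Proof.
move=> iE kk'; rewrite /learned; congr (_%:R / _); apply: eq_card => a.
by rewrite !inE /= ffunE iE /= (negPf kk').
Qed.

Lemma learned_known i next k p w w' L M : enum_val i = inl (p, w) ->
  (p, w') \in L -> learned (Query i next) k L M = learned (next (w' == w)) k L M.
Proof.
move=> iE pL; rewrite /learned; congr (_%:R / _); apply: eq_card => a.
rewrite !inE; case: (boolP (all _ L)) => //= /allP/(_ _ pL)/= /eqP <-.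
by rewrite ffunE iE.
Qed.

(** While the queried points lie on distinct lines, both models are [D]-wise independent there and
    [freq_close] applies; the bound is the same for all such keys. *)
Lemma fr_nu k L M : {in unzip1 (L ++ M) &, injective (line k)} ->
  uniq (unzip1 L) -> (size L <= D)%N ->
  fr k L M <= nu L M + 'C(size M, D - size L)%:R * s^-1 ^+ D.
Proof.
move=> line_inj uL sL; rewrite -lerBlDl.
apply: le_trans (ler_norm _) _.
apply: (freq_close (X := [in unzip1 (L ++ M)])) => //.
  exact: independent_monic_eval.
exact: independent_ffun.
Qed.

(* [K] collects the keys under which two queried points collide, or at which the
   second table was read; success on these keys is given away. The first term of
   the bound pays for them as if the cells were uniformly random, the second one
   for the error in [freq_close] and for the paths with [D] positive answers. *)
Lemma learned_bound (T : nat) (t : decision_tree #|position|) : (D <= T)%N ->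
  forall (n : nat) (L M : seq (F * F * W)) (K : {set F}),
  (depth t <= n)%N -> (size L + size M + n <= T)%N ->
  uniq (unzip1 L) -> (size L <= D)%N ->
  (forall k, k \notin K -> {in unzip1 (L ++ M) &, injective (line k)}) ->
  \sum_(k | k \notin K) learned t k L M <=
    (n * T)%:R * nu L M + (q + n * T)%:R * 'C(T + n, D - size L)%:R * s^-1 ^+ D.
Proof.
move=> leDT; have s_gt0 : 0 < s by rewrite ltr0n.
have sD_ge0 : 0 <= s^-1 ^+ D by rewrite exprn_ge0 ?invr_ge0 // ltW.
have nu_ge0 L M : 0 <= nu L M by exact: freq_ge0.
elim: t => [h|i next IH] n L M K dt szT uL sL line_inj.
  (* At a leaf each key contributes at most [q^-D], hence at most [s^-D]. *)
  apply: le_trans (ler_wpDl (mulr_ge0 (ler0n _ _) (nu_ge0 _ _)) (lexx _)).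
  apply: le_trans (_ : \sum_(k in F) #|{ffun 'I_D -> F}|%:R^-1 <= _).
    rewrite big_mkcond; apply: ler_sum => k _; case: ifP => _; last by rewrite invr_ge0.
    exact: learned_output.
  rewrite sumr_const card_ffun card_ord natrX -exprVn -[leLHS]mulr_natl.
  have bin_ge1 : 1 <= 'C(T + n, D - size L)%:R :> R by rewrite ler1n bin_gt0; lia.
  have qW : q%:R^-1 <= s^-1 by rewrite lef_pV2 ?posrE ?ler_nat ?ltr0n // (leq_trans W_gt0).
  apply: ler_pM => //.
    by rewrite -[leLHS]mulr1 ler_pM // ler_nat leq_addr.
  by rewrite lerXn2r // nnegrE invr_ge0.
(* After [D] positive answers the transcript itself has frequency at most [s^-D] for each key,
   whatever the tree does next. *)
have [szD|szD] := eqVneq (size L) D.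
  apply: le_trans (ler_wpDl (mulr_ge0 (ler0n _ _) (nu_ge0 _ _)) (lexx _)).
  apply: le_trans (_ : \sum_(k in F) s^-1 ^+ D <= _).
    rewrite big_mkcond; apply: ler_sum => k _; case: ifP => // kK.
    apply: le_trans (learned_le _ _ _ _) _; apply: le_trans (freq_le _ _ _ _) _.
    rewrite (independent_monic_eval leDF pi_bal (line_inj k kK)) ?szD //.
    by move=> p pL; rewrite /unzip1 map_cat mem_cat pL.
  by rewrite sumr_const szD subnn bin0 mulr1 -[leLHS]mulr_natl ler_wpM2r // ler_nat leq_addr.
have dtb b : (depth (next b) < n)%N.
  by apply: leq_trans dt; rewrite /= ltnS leq_max; case: b; rewrite leqnn ?orbT.
have {}szD : (size L < D)%N by rewrite ltn_neqAle szD.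
case: n dt szT dtb => // n _ szT dtb.
have nuK c : nu L M = nu (c :: L) M + nu L (c :: M) by exact: freq_split.
have binM : 'C(size M, D - size L)%:R * s^-1 ^+ D
    <= 'C(T + n.+1, D - size L)%:R * s^-1 ^+ D.
  rewrite ler_wpM2r // ler_nat leq_bin2l //; lia.
have binT : 'C(T + n, D - size L)%:R * s^-1 ^+ D
    <= 'C(T + n.+1, D - size L)%:R * s^-1 ^+ D.
  rewrite ler_wpM2r // ler_nat leq_bin2l //; lia.
(* Keys newly given away are charged the whole frequency of the transcript, estimated by [fr_nu]. *)
have splitK (K' : {set F}) t0 : K \subset K' ->
    \sum_(k | k \notin K) learned t0 k L M
    <= #|K' :\: K|%:R * (nu L M + 'C(T + n.+1, D - size L)%:R * s^-1 ^+ D)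
       + \sum_(k | k \notin K') learned t0 k L M.
  move=> sKK'; rewrite (bigID (mem K')) /=; apply: lerD; last first.
    rewrite le_eqVlt; apply/predU1P; left; apply: eq_bigl => k.
    by case: (boolP (k \in K)) => // kK; rewrite (fintype.subsetP sKK' _ kK).
  apply: le_trans (_ : \sum_(k in K' :\: K)
    (nu L M + 'C(T + n.+1, D - size L)%:R * s^-1 ^+ D) <= _); last first.
    by rewrite sumr_const -[leLHS]mulr_natl.
  rewrite (eq_bigl (mem (K' :\: K))) => [|k]; last by rewrite !inE.
  apply: ler_sum => k /setDP[_ kK].
  apply: le_trans (learned_le _ _ _ _) _.
  by apply: le_trans (fr_nu (line_inj k kK) uL sL) _; rewrite lerD2l.
case E: (enum_val i) => [[p w]|[[k' j] z]].
  (* If the cell of [p] is already known, the answer is determined and nothing branches. *)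
  have [/mapP[[p' w'] /= pwL pp']|pL] := boolP (p \in unzip1 L).
    subst p'; under eq_bigr do rewrite (learned_known _ _ _ E pwL).
    by apply: IH => //; exact: ltnW.
  (* Otherwise give away the keys that put [p] on the line of an earlier query, at most one key per
     earlier query. *)
  pose K' := K :|: [set k in map (slope p) (unzip1 (L ++ M))].
  have cK' : (#|K' :\: K| <= T)%N.
    apply: leq_trans (_ : #|[set k in map (slope p) (unzip1 (L ++ M))]| <= _)%N.
      by apply: subset_leq_card; rewrite subDset subxx.
    by rewrite cardsE (leq_trans (card_size _)) // !size_map size_cat; lia.
  apply: le_trans (splitK K' _ (finset.subsetUl _ _)) _.
  under eq_bigr do rewrite (learned_point _ _ _ _ E).
  rewrite big_split /=.
  have inj' k : k \notin K' -> {in p :: unzip1 (L ++ M) &, injective (line k)}.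
    rewrite !inE negb_or => /andP[kK /mapP kS] x y; rewrite !inE.
    have new u : u \in unzip1 (L ++ M) -> line k p = line k u -> p = u.
      move=> uLM eqpu; apply/eqP; apply: contraT => pu.
      by case: kS; exists u => //; exact: line_slope.
    move=> /predU1P[->|xLM] /predU1P[->|yLM] // exy; first exact: new.
      by apply/esym/new.
    exact: (line_inj k kK).
  have sz1 : (size ((p, w) :: L) + size M + n <= T)%N by rewrite /=; lia.
  have sz0 : (size L + size ((p, w) :: M) + n <= T)%N by rewrite /=; lia.
  have uL1 : uniq (unzip1 ((p, w) :: L)) by rewrite /= pL.
  have inj0 k : k \notin K' ->
      {in unzip1 (L ++ (p, w) :: M) &, injective (line k)}.
    have sub u : u \in unzip1 (L ++ (p, w) :: M) -> u \in p :: unzip1 (L ++ M).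
      by rewrite /unzip1 !map_cat !(mem_cat, inE) orbCA.
    by move=> /inj' kinj x y xL yL; apply: kinj; exact: sub.
  have I1 := IH true n ((p, w) :: L) M K' (dtb true) sz1 uL1 szD inj'.
  have I0 := IH false n L ((p, w) :: M) K' (dtb false) sz0 uL sL inj0.
  apply: le_trans (lerD (lexx _) (lerD I1 I0)) _ => /=.
  rewrite (nuK (p, w)).
  have [r rE] : exists r, (D - size L = r.+1)%N.
    by exists (D - size L).-1; clear -szD; lia.
  have -> : (D - (size L).+1 = r)%N by clear -rE; lia.
  (* Pascal's rule adds the error terms of the two branches; what remains is the unspent part of the
     allowance of [T] keys per query. *)
  rewrite rE addnS binS !natrD !natrM.
  have cK'R : #|K' :\: K|%:R <= T%:R :> R by rewrite ler_nat.
  rewrite -subr_ge0; set lhs := (X in _ - X).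
  rewrite [X in 0 <= X](_ : _ = (T%:R - #|K' :\: K|%:R)
    * (nu ((p, w) :: L) M + nu L ((p, w) :: M)
       + ('C(T + n, r.+1)%:R + 'C(T + n, r)%:R) * s^-1 ^+ D)); last by rewrite /lhs; ring.
  by rewrite mulr_ge0 ?subr_ge0 // !addr_ge0 // mulr_ge0 // addr_ge0.
(* A query to the second table is answered negatively under every key but [k'], so only [k'] is
   given away. *)
pose K' := K :|: [set k'].
have cK' : (#|K' :\: K| <= T)%N.
  apply: leq_trans (_ : #|[set k']| <= _)%N; last by rewrite cards1; lia.
  by apply: subset_leq_card; rewrite subDset subxx.
apply: le_trans (splitK K' _ (finset.subsetUl _ _)) _.
rewrite (eq_bigr (fun k => learned (next false) k L M)) => [|k]; last first.
  rewrite !inE negb_or => /andP[_ kk']; apply: (learned_key _ _ _ E).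
  by rewrite eq_sym.
have sz0 : (size L + size M + n <= T)%N by lia.
have inj0 k : k \notin K' -> {in unzip1 (L ++ M) &, injective (line k)}.
  by rewrite !inE negb_or => /andP[kK _]; exact: line_inj.
have I0 := IH false n L M K' (dtb false) sz0 uL sL inj0.
apply: le_trans (lerD (lexx _) I0) _.
have cK'R : #|K' :\: K|%:R <= T%:R :> R by rewrite ler_nat.
rewrite !natrD !natrM.
have C_ge0 := mulr_ge0 (ler0n R 'C(T + n.+1, D - size L)) sD_ge0.
have h1 := ler_wpM2r (addr_ge0 (nu_ge0 L M) C_ge0) cK'R.
have h2 : (q%:R + n%:R * T%:R) * ('C(T + n, D - size L)%:R * s^-1 ^+ D)
    <= (q%:R + n%:R * T%:R) * ('C(T + n.+1, D - size L)%:R * s^-1 ^+ D).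
  by rewrite ler_wpM2l // addr_ge0 // mulr_ge0.
by move: h1 h2; lra.
Qed.

End Adversary.
End HiddenClass.

(** * Randomized lower bound *)

Lemma expn_leq_ffact m n : (m <= n)%N -> ((n - m).+1 ^ m <= n ^_ m)%N.
Proof.
elim: m n => [|m IH] [|n] //; rewrite ltnS => mn.
by rewrite ffactSS subSS expnS leq_mul ?ltnS ?leq_subr // IH.
Qed.

Lemma ffact_leq_expn m n : (n ^_ m <= n ^ m)%N.
Proof. by elim: m => // m IH; rewrite ffactnSr expnSr leq_mul // leq_subr. Qed.

Lemma bin_leq_exp2 n k : ('C(n, k) <= 2 ^ n)%N.
Proof.
elim: n k => [|n IH] [|k] //; first by rewrite bin0 expn_gt0.
by rewrite binS expnS mul2n -addnn leq_add.
Qed.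

(** With [D = 4 * u], the falling factorial of [D + D] of length [D] is at least [D ^ D], and it is
    the factorial of [D] times a binomial of size at most [4 ^ D]. *)
Lemma expn_leq_fact u : (0 < u)%N -> (u ^ (4 * u) <= (4 * u)`!)%N.
Proof.
move=> u_gt0; set D := (4 * u)%N; have D_gt0 : (0 < D)%N by rewrite muln_gt0.
have uD : (4 ^ D * u ^ D = D ^ D)%N by rewrite -expnMn.
rewrite -(leq_pmul2l (_ : 0 < 4 ^ D)%N) ?expn_gt0 // uD.
apply: leq_trans (_ : 'C(D + D, D) * D`! <= _)%N.
  rewrite bin_ffact; apply: leq_trans (expn_leq_ffact (leq_addr _ _)).
  by rewrite addnK leq_exp2r.
by rewrite leq_mul2r (leq_trans (bin_leq_exp2 _ _)) ?orbT // addnn -mul2n expnM.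
Qed.

(** With [D = 4 * u], the binomial is at most [(2 * u ^ 3) ^ D / u ^ D = (2 * u ^ 2) ^ D], against
    [(16 * u ^ 2) ^ D] in the denominator. This makes the error term of [learned_bound] small. *)
Lemma bin_small_ratio (R : realFieldType) (u : nat) : (0 < u)%N ->
  'C(u ^ 3 + u ^ 3, 4 * u)%:R * ((4 * u) ^ 2)%:R^-1 ^+ (4 * u) <= 8^-1 :> R.
Proof.
move=> u_gt0; set D := (4 * u)%N.
have D_gt0 : (0 < D)%N by rewrite muln_gt0.
rewrite exprVn -natrX ler_pdivrMr ?ltr0n ?expn_gt0 ?D_gt0 //.
rewrite mulrC ler_pdivlMr // -natrM ler_nat.
have uD_gt0 : (0 < u ^ D)%N by rewrite expn_gt0 u_gt0.
rewrite -(leq_pmul2r uD_gt0).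
apply: leq_trans (_ : 'C(u ^ 3 + u ^ 3, D) * 8 * D`! <= _)%N.
  by rewrite leq_mul2l expn_leq_fact ?orbT.
rewrite mulnAC bin_ffact.
apply: leq_trans (_ : (u ^ 3 + u ^ 3) ^ D * 8 ^ D <= _)%N.
  apply: leq_mul; first exact: ffact_leq_expn.
  by rewrite -[leqLHS]expn1; apply: leq_pexp2l.
by rewrite -!expnMn leq_exp2r //; rewrite /D; lia.
Qed.

Lemma card_mul_le_sum (R : numDomainType) (I : finType) (x : R) (f : I -> R) :
  (forall i, x <= f i) -> x * #|I|%:R <= \sum_i f i.
Proof. by move=> le_xf; rewrite mulr_natr -sumr_const; apply: ler_sum. Qed.

Section RandomizedLower.
Variables (R : realType) (F : finFieldType) (W : finType).
Variables (lam : F -> bool) (pi : F -> W) (D : nat).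
Hypothesis lamD : {morph lam : x y / x + y >-> x (+) y}.
Hypothesis lam_neq0 : exists x, lam x.
Hypothesis W_gt0 : (0 < #|W|)%N.
Hypothesis leWF : (#|W| <= #|F|)%N.
Hypothesis leDF : (D <= #|F|)%N.
Hypothesis pi_bal :
  forall w, #|[set v | pi v == w]|%:R / #|F|%:R = #|W|%:R^-1 :> R.

(** Averaging argument: the success guarantee is averaged over the polynomials, summed over the keys
    and exchanged with the sum over seeds; [learned_bound] from the empty transcript then limits
    each seed. *)
Lemma hidden_learnable_bound T T' :
  randomized_learnable R (hidden_class lam pi D) T -> (T <= T')%N -> (D <= T')%N ->
  2 / 3 * #|F|%:R <= (T' * T')%:R
    + (#|F| + T' * T')%:R * 'C(T' + T', D)%:R * #|W|%:R^-1 ^+ D :> R.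
Proof.
case=> m [p [t [p_ge0 p_sum dt tC]]] leTT' leDT'; set B := (X in _ <= X).
pose A : finType := {ffun 'I_D -> F}.
have A_gt0 : 0 < #|A|%:R :> R by rewrite ltr0n; apply/card_gt0P; exists 0.
have bound s : \sum_k learned lam pi R (t s) k [::] [::] <= B.
  have := learned_bound lamD lam_neq0 W_gt0 leWF leDF pi_bal (t := t s) leDT'
    (n := T') (L := [::]) (M := [::]) (K := finset.set0) (leq_trans (dt s) leTT')
    (leqnn _) isT isT.
  rewrite subn0 (eq_bigl predT) => [|k]; last by rewrite inE.
  move=> bnd; apply: le_trans (bnd _) _ => // {bnd}.
  rewrite lerD2r ler_piMr // /freq ler_pdivrMr ?mul1r ?ler_nat ?max_card //.
  rewrite ltr0n card_ffun expn_gt0 W_gt0 //.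
have success k a : 2 / 3 <= \sum_s p s * (run (t s) (hidden_concept lam pi k a)
    == hidden_concept lam pi k a)%:R.
  apply: le_trans (tC _ (hidden_concept_in lam pi k a)) _.
  rewrite big_mkcond; apply: ler_sum => s _.
  by case: eqP; rewrite ?mulr1 ?mulr0.
have avg k : 2 / 3 <= \sum_s p s * learned lam pi R (t s) k [::] [::].
  rewrite -(ler_pM2r A_gt0); apply: le_trans (card_mul_le_sum (success k)) _.
  rewrite exchange_big /= mulr_suml le_eqVlt; apply/predU1P; left.
  apply: eq_bigr => s _; rewrite /learned -mulr_sumr -mulrA divfK ?lt0r_neq0 //.
  congr (_ * _); rewrite -natr_sum; congr _%:R; rewrite -sum1_card [RHS]big_mkcond /=.
  by apply: eq_bigr => a _; rewrite inE; case: eqP.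
apply: le_trans (card_mul_le_sum avg) _; rewrite exchange_big /=.
apply: le_trans (_ : \sum_s p s * B <= _); last by rewrite -mulr_suml p_sum mul1r.
by apply: ler_sum => s _; rewrite -mulr_sumr ler_wpM2l.
Qed.

(** For [T <= u ^ 3] the two terms of the bound are at most [1 / 8] and [9 / 64] of the number of
    keys, short of [2 / 3]. *)
Lemma randomized_complexity_lower u T : (2 <= u)%N ->
  D = (4 * u)%N -> #|W| = (D ^ 2)%N -> #|F| = (D ^ 8)%N ->
  randomized_learnable R (hidden_class lam pi D) T -> (u ^ 3 < T)%N.
Proof.
move=> u_ge2 DE WE FE learnT; rewrite ltnNge; apply/negP => leT.
have leDu : (D <= u ^ 3)%N.
  have le4 : (2 ^ 2 <= u ^ 2)%N by rewrite leq_sqr.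
  by rewrite DE expnS mulnC leq_mul2l le4 orbT.
have := hidden_learnable_bound learnT leT leDu.
have u_gt0 : (0 < u)%N by exact: ltnW.
have small := bin_small_ratio R u_gt0; rewrite -DE -WE in small.
have T2F : (u ^ 3 * (u ^ 3))%:R <= 8^-1 * #|F|%:R :> R.
  rewrite mulrC ler_pdivlMr // -natrM ler_nat FE DE.
  rewrite -expnD expnMn mulnC leq_mul // leq_pexp2l //.
move=> big.
have F_gt0 : 0 < #|F|%:R :> R by rewrite ltr0n; apply/card_gt0P; exists 0.
have h : (#|F|%:R + (u ^ 3 * u ^ 3)%:R) *
     ('C(u ^ 3 + u ^ 3, D)%:R * #|W|%:R^-1 ^+ D) <= (#|F|%:R + 8^-1 * #|F|%:R) * 8^-1 :> R.
  by apply: ler_pM => //; rewrite lerD2l.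
by move: big h T2F F_gt0; rewrite natrD -mulrA; lra.
Qed.

End RandomizedLower.

(** * Quantum lower bound *)

(** Cauchy-Schwarz against the constant 1, from the squares of [r i - r j]. *)
Lemma sqr_sum_le (C : numDomainType) (I : finType) (r : I -> C) :
  (forall j, 0 <= r j) -> (\sum_j r j) ^+ 2 <= #|I|%:R * \sum_j r j ^+ 2.
Proof.
move=> r_ge0; rewrite -(ler_pM2l (ltr0n C 2)) expr2 big_distrlr /=.
have -> : 2 * (#|I|%:R * \sum_j r j ^+ 2) = \sum_i \sum_j (r i ^+ 2 + r j ^+ 2).
  transitivity (\sum_(i : I) (#|I|%:R * r i ^+ 2 + \sum_j r j ^+ 2)).
    rewrite big_split /= -mulr_sumr mulr2n mulrDl mul1r; congr (_ + _).
    by rewrite mulr_natl -sumr_const; exact: eq_bigl.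
  apply: eq_bigr => i _; rewrite big_split /=; congr (_ + _).
  by rewrite mulr_natl -sumr_const; exact: eq_bigl.
rewrite mulr_sumr; apply: ler_sum => i _; rewrite mulr_sumr; apply: ler_sum => j _.
rewrite -subr_ge0 (_ : _ - _ = (r i - r j) ^+ 2); last by ring.
by rewrite real_exprn_even_ge0 // realB ?ger0_real.
Qed.

Section QuantumState.
Variables (R : realType) (N w : nat).
Local Notation C := R[i].
Local Notation basis := (qbasis N w).
Local Notation state := (qstate R N w).
Implicit Types (psi : state) (c : concept N).

Definition amplitude psi (x : basis) : C := psi (enum_rank x) 0.

Lemma amplitude_sum (I : finType) (P : pred I) (v : I -> state) x :
  amplitude (\sum_(j | P j) v j) x = \sum_(j | P j) amplitude (v j) x.
Proof. exact: summxE. Qed.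

Lemma amplitude_query c psi x :
  amplitude (query_mx R w c *m psi) x = amplitude psi (query_basis c x).
Proof.
rewrite /amplitude !mxE (bigD1 (enum_rank (query_basis c x))) //=.
have query_basisK y : query_basis c (query_basis c y) = y.
  by case: y => [[i b] z]; rewrite /= addbK.
rewrite !mxE !enum_rankK query_basisK eqxx mul1r big1 ?addr0 // => j jx.
rewrite !mxE enum_rankK; case: eqP => [xE|]; last by rewrite mul0r.
by move: jx; rewrite xE query_basisK enum_valK eqxx.
Qed.

Definition col_of (f : basis -> C) : state := \col_i f (enum_val i).

Lemma amplitude_col_of f x : amplitude (col_of f) x = f x.
Proof. by rewrite /amplitude mxE enum_rankK. Qed.

Lemma state_eqP psi psi' : amplitude psi =1 amplitude psi' -> psi = psi'.
Proof.
move=> eqpsi; apply/colP => i; rewrite -(enum_valK i); exact: eqpsi.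
Qed.

Lemma sum_amplitude (f : 'I_#|basis| -> C) : \sum_i f i = \sum_x f (enum_rank x).
Proof. by rewrite (reindex _ (onW_bij _ (enum_rank_bij _))). Qed.

Definition sqnorm psi : C := measure_prob psi predT.

Lemma sqnorm_unitary (U : qoperator R N w) psi :
  U \is unitarymx -> sqnorm (U *m psi) = sqnorm psi.
Proof.
move=> /unitarymxP/mulmx1C UU.
have sqnormE phi : sqnorm phi = (map_mx Num.conj phi^T *m phi) 0 0.
  rewrite mxE sum_amplitude; apply: eq_bigr => x _.
  by rewrite !mxE mulrC normCK.
by rewrite !sqnormE trmx_mul map_mxM mulmxA -(mulmxA _ _ U) UU mulmx1.
Qed.

(** The action of a query on index [i] when the answer is [b]. These [2 * N] operators are fixed; a
    concept only selects [N] of them. *)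
Definition piece (i : 'I_N) (b : bool) psi : state :=
  col_of (fun x => (x.1.1 == i)%:R * amplitude psi (i, b (+) x.1.2, x.2)).

Lemma query_mx_pieces c psi : query_mx R w c *m psi = \sum_i piece i (c i) psi.
Proof.
apply: state_eqP => x; rewrite amplitude_query amplitude_sum.
case: x => [[i b] z]; rewrite (bigD1 i) //= amplitude_col_of eqxx mul1r addbC.
rewrite big1 ?addr0 // => j ji.
by rewrite amplitude_col_of /= eq_sym (negPf ji) mul0r.
Qed.

Lemma piece_sum i b (I : finType) (P : pred I) (v : I -> state) :
  piece i b (\sum_(j | P j) v j) = \sum_(j | P j) piece i b (v j).
Proof.
apply: state_eqP => x; rewrite amplitude_sum amplitude_col_of amplitude_sum mulr_sumr.
by apply: eq_bigr => j _; rewrite amplitude_col_of.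
Qed.

Lemma sqnorm_piece i b psi : sqnorm (piece i b psi) <= sqnorm psi.
Proof.
pose g (x : basis) : basis := (x.1.1, b (+) x.1.2, x.2).
have g_inj : injective g.
  by move=> [[i1 b1] z1] [[i2 b2] z2] [-> /addbI-> ->].
rewrite /sqnorm /measure_prob [leRHS](reindex_inj g_inj); apply: ler_sum => x _.
have := amplitude_col_of (fun x => (x.1.1 == i)%:R * amplitude psi (i, b (+) x.1.2, x.2)) x.
rewrite /amplitude => ->; case: eqP => [<-|_]; first by rewrite mul1r.
by rewrite mul0r normr0 expr0n exprn_ge0.
Qed.

(** Expanding every query into pieces gives one fixed vector per sequence of indices and answers;
    pieces never increase the norm. *)
Lemma final_state_pieces (U : nat -> qoperator R N w) psi T :
  (forall t, U t \is unitarymx) -> sqnorm psi = 1 ->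
  exists (I : finType) (v : I -> state) (S : concept N -> {set I}),
    [/\ #|I| = ((2 * N) ^ T)%N, forall j, sqnorm (v j) <= 1
      & forall c, final_state U c psi T = \sum_(j in S c) v j].
Proof.
move=> U_unit psi1; elim: T => [|T [I [v [S [cardI v_le1 vE]]]]].
  exists unit, (fun=> U 0%N *m psi), (fun=> [set: unit]); split.
  - by rewrite card_unit.
  - by move=> _; rewrite sqnorm_unitary // psi1.
  - by move=> c; rewrite (big_pred1 tt) // => -[]; rewrite inE.
exists ('I_N * bool * I)%type, (fun x => U T.+1 *m piece x.1.1 x.1.2 (v x.2)).
exists (fun c => [set x | (x.1.2 == c x.1.1) && (x.2 \in S c)]); split.
- by rewrite !card_prod card_ord card_bool cardI expnS (mulnC N).
- by move=> x; rewrite sqnorm_unitary // (le_trans (sqnorm_piece _ _ _)).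
- move=> c; rewrite /= query_mx_pieces vE mulmx_sumr.
  rewrite (eq_bigr (fun i => \sum_(j in S c) U T.+1 *m piece i (c i) (v j)))
    => [|i _]; last first.
    by rewrite piece_sum mulmx_sumr.
  rewrite pair_big_dep /=.
  rewrite (reindex_onto (fun x => (x.1, c x.1, x.2))
    (fun y : 'I_N * bool * I => (y.1.1, y.2))) /=.
    apply: eq_bigl => -[i j]; by rewrite !inE /= !eqxx andbT.
  by move=> [[i b] j]; rewrite inE /= => /andP[/eqP-> _].
Qed.

End QuantumState.

(** By Cauchy-Schwarz the probability of an outcome [x] is at most [#|I|] times the sum of the
    squared amplitudes of all [v j] at [x], for every concept. Each [x] serves only the hypothesis
    [out x], so summing over concepts gives [2 / 3 * #|C| <= #|I| ^ 2]. *)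
Lemma quantum_learnable_card (R : realType) (N : nat) (C : concept_class N) T :
  quantum_learnable R C T -> (2 * #|C| <= 3 * ((2 * N) ^ T) ^ 2)%N.
Proof.
case=> w [psi [U [out [psi1 U_unit learns]]]].
have [I [v [S [cardI v_le1 vE]]]] := final_state_pieces T U_unit psi1.
have amp2_ge0 (z : R[i]) : 0 <= `|z| ^+ 2 by rewrite exprn_ge0.
have cs c x : `|amplitude (final_state U c psi T) x| ^+ 2
    <= #|I|%:R * \sum_j `|amplitude (v j) x| ^+ 2.
  rewrite vE amplitude_sum.
  apply: le_trans (_ : (\sum_j `|amplitude (v j) x|) ^+ 2 <= _); last exact: sqr_sum_le.
  rewrite lerXn2r ?nnegrE ?sumr_ge0 //; apply: le_trans (ler_norm_sum _ _ _) _.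
  by rewrite big_mkcond; apply: ler_sum => j _; case: ifP.
have cardC : 2 / 3 * #|C|%:R <= (#|I| ^ 2)%:R :> R[i].
  rewrite mulr_natr -sumr_const.
  apply: le_trans (_ : \sum_c \sum_(x | out x == c)
    #|I|%:R * \sum_j `|amplitude (v j) x| ^+ 2 <= _).
    rewrite big_mkcond; apply: ler_sum => c _; case: ifP => cC.
      by apply: le_trans (learns c cC) _; apply: ler_sum => x _; exact: cs.
    by apply: sumr_ge0 => x _; rewrite mulr_ge0 // sumr_ge0.
  rewrite (exchange_big_dep predT) //=.
  rewrite (eq_bigr (fun x => #|I|%:R * \sum_j `|amplitude (v j) x| ^+ 2))
    => [|x _]; last first.
    by rewrite (big_pred1 (out x)) // => c; rewrite eq_sym.
  rewrite -mulr_sumr natrX expr2 ler_wpM2l // exchange_big /=.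
  rewrite -sumr_const; apply: le_trans (_ : \sum_(j : I) 1 <= _).
    by apply: ler_sum => j _; exact: v_le1.
  by rewrite le_eqVlt; apply/predU1P; left; apply: eq_bigl.
rewrite -cardI -(ler_nat R[i]) (natrM _ 2) (natrM _ 3).
have -> : 2 * #|C|%:R = 3 * (2 / 3 * #|C|%:R) :> R[i] by field.
by rewrite ler_wpM2l.
Qed.

(** * Algorithms with real amplitudes and phase queries *)

Lemma sum_triple (V : nmodType) (A B D : finType) (f : A * B * D -> V) :
  \sum_x f x = \sum_d \sum_b \sum_a f (a, b, d).
Proof.
under [RHS]eq_bigr do rewrite exchange_big.
rewrite exchange_big /= (eq_bigr (fun a => \sum_d \sum_b f (a, b, d))) //.
rewrite (eq_bigr (fun a => \sum_b \sum_d f (a, b, d))) => [|a _]; last exact: exchange_big.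
by rewrite !pair_bigA; apply: eq_bigr => -[[]].
Qed.

Section Kernels.
Variables (R : pzRingType) (X : finType).

Definition kernel_apply (u : X -> X -> R) (f : X -> R) : X -> R :=
  fun x => \sum_y u x y * f y.

Definition orthogonal_kernel (u : X -> X -> R) : Prop :=
  forall x x', \sum_y u x y * u x' y = (x == x')%:R.

End Kernels.

Section PhaseAlgorithm.
Variables (R : realType) (N : nat) (Z : finType).
Local Notation toC := (real_complex R).

Fixpoint phase_state (pos : nat -> Z -> 'I_N) (u : nat -> Z -> Z -> R)
    (c : concept N) (psi : Z -> R) (T : nat) : Z -> R :=
  match T with
  | 0 => kernel_apply (u 0%N) psi
  | t.+1 => kernel_apply (u t.+1)
      (fun z => (-1) ^+ c (pos t z) * phase_state pos u c psi t z)
  end.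

Let w := #|Z|.
Local Notation basis := (qbasis N w).

Lemma real_complex_norm (x : R) : `|toC x| ^+ 2 = toC (x ^+ 2).
Proof. by rewrite -add_Re2_Im2 /= expr0n addr0. Qed.

Lemma real_complex_conj (x : R) : Num.conj (toC x) = toC x.
Proof. by apply: conj_Creal; apply/complex_realP; exists x. Qed.

Definition kernel_mx (k : basis -> basis -> R) : qoperator R N w :=
  \matrix_(i, j) toC (k (enum_val i) (enum_val j)).

Lemma kernel_mx_unitary k : orthogonal_kernel k -> kernel_mx k \is unitarymx.
Proof.
move=> k_orth; apply/unitarymxP/matrixP => i j; rewrite !mxE sum_amplitude.
under eq_bigr do rewrite !mxE enum_rankK real_complex_conj -rmorphM.
rewrite -rmorph_sum k_orth (inj_eq enum_val_inj).
by case: (i == j); rewrite ?rmorph1 ?rmorph0.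
Qed.

Lemma kernel_mx_mul k (f : basis -> R) :
  kernel_mx k *m col_of (toC \o f) = col_of (toC \o kernel_apply k f).
Proof.
apply: state_eqP => x; rewrite amplitude_col_of /amplitude mxE sum_amplitude.
rewrite /= rmorph_sum; apply: eq_bigr => y _.
by rewrite !mxE !enum_rankK rmorphM.
Qed.

(* The answer register stays in the state (|0> - |1>)/sqrt 2 and the query
   register always holds [p z], so that a query multiplies by a phase. *)
Definition embed (p : Z -> 'I_N) (f : Z -> R) (x : basis) : R :=
  (x.1.1 == p (enum_val x.2))%:R * ((-1) ^+ x.1.2 / Num.sqrt 2) * f (enum_val x.2).

Lemma sum_workspace (f : 'I_w -> R) : \sum_z f z = \sum_(z : Z) f (enum_rank z).
Proof. by rewrite (reindex _ (onW_bij _ (enum_rank_bij _))). Qed.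

Lemma sum_embed p f (A : pred Z) :
  \sum_(x | A (enum_val x.2)) embed p f x ^+ 2 = \sum_(z | A z) f z ^+ 2.
Proof.
rewrite big_mkcond sum_triple sum_workspace [RHS]big_mkcond; apply: eq_bigr => z _ /=.
rewrite enum_rankK; case: ifP => Az; last by rewrite !big1 // => b _; rewrite big1.
rewrite (eq_bigr (fun=> f z ^+ 2 / 2)) => [|b _].
  by rewrite sumr_const card_bool mulr2n -splitr.
rewrite (bigD1 (p z)) //= big1 ?addr0 => [|i ip]; last first.
  by rewrite /embed /= enum_rankK (negPf ip) !mul0r expr0n.
rewrite /embed /= enum_rankK eqxx mul1r !exprMn sqrr_sign mul1r exprVn sqr_sqrtr //.
by rewrite mulrC.
Qed.

Lemma query_embed c p f : query_mx R w c *m col_of (toC \o embed p f) =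
  col_of (toC \o embed p (fun z => (-1) ^+ c (p z) * f z)).
Proof.
apply: state_eqP => -[[i b] z]; rewrite amplitude_query !amplitude_col_of /=.
congr (toC _); rewrite /embed /=; case: eqP => [->|_]; last by rewrite !mul0r.
by rewrite signr_addb; ring.
Qed.

Variable i0 : 'I_N.

Definition lift_kernel (p p' : Z -> 'I_N) (u : Z -> Z -> R) (x y : basis) : R :=
  ((x.1.2 == y.1.2)
   && (tperm i0 (p (enum_val x.2)) x.1.1 == tperm i0 (p' (enum_val y.2)) y.1.1))%:R
  * u (enum_val x.2) (enum_val y.2).

Lemma lift_kernel_orthogonal p p' u :
  orthogonal_kernel u -> orthogonal_kernel (lift_kernel p p' u).
Proof.
move=> u_orth [[i b] z] [[i' b'] z']; rewrite sum_triple sum_workspace /lift_kernel /=.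
set j := tperm i0 (p (enum_val z)) i; set j' := tperm i0 (p (enum_val z')) i'.
transitivity (\sum_y ((b == b') && (j == j'))%:R * (u (enum_val z) y * u (enum_val z') y)).
  apply: eq_bigr => y _; rewrite enum_rankK.
  rewrite (bigD1 b) //= [X in _ + X]big1 ?addr0 => [|b1 bb1]; last first.
    by apply: big1 => i1 _; rewrite eq_sym (negPf bb1) !mul0r.
  rewrite (bigD1 (tperm i0 (p' y) j)) //= [X in _ + X]big1 ?addr0 => [|i1 ji1]; last first.
    rewrite eqxx /= (_ : j == _ = false) ?mul0r //.
    by apply: contraNF ji1 => /eqP->; rewrite tpermK.
  by rewrite tpermK !eqxx mul1r (eq_sym b') (eq_sym j'); ring.
rewrite -mulr_sumr u_orth (inj_eq enum_val_inj) -natrM mulnb; congr (_%:R).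
rewrite !xpair_eqE /j /j'; have [->|_] := eqVneq z z'; last by rewrite !andbF.
by rewrite !andbT (inj_eq perm_inj) andbC.
Qed.

Lemma apply_lift_kernel p p' u f :
  kernel_apply (lift_kernel p p' u) (embed p' f) =1 embed p (kernel_apply u f).
Proof.
move=> [[i b] z]; rewrite /kernel_apply sum_triple sum_workspace {2}/embed /= mulr_sumr.
apply: eq_bigr => y _; rewrite (bigD1 b) //= [X in _ + X]big1 ?addr0 => [|b1 bb1]; last first.
  by apply: big1 => i1 _; rewrite /lift_kernel /= eq_sym (negPf bb1) !mul0r.
rewrite (bigD1 (p' y)) //= [X in _ + X]big1 ?addr0 => [|i1 pi1]; last first.
  by rewrite /embed /= enum_rankK (negPf pi1) !mul0r mulr0.
rewrite /embed /lift_kernel /= enum_rankK !eqxx /= tpermR mul1r.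
have -> : (tperm i0 (p (enum_val z)) i == i0) = (i == p (enum_val z)).
  by rewrite -[X in _ == X](tpermR i0 (p (enum_val z))) (inj_eq perm_inj).
by ring.
Qed.

Lemma phase_learnable (C : concept_class N) (T : nat) (pos : nat -> Z -> 'I_N)
    (u : nat -> Z -> Z -> R) (psi : Z -> R) (out : Z -> concept N) :
  \sum_z psi z ^+ 2 = 1 -> (forall t, orthogonal_kernel (u t)) ->
  (forall c, c \in C ->
     2 / 3 <= \sum_(z | out z == c) phase_state pos u c psi T z ^+ 2) ->
  quantum_learnable R C T.
Proof.
move=> psi1 u_orth learns.
(* At [t = 0] the predecessor is 0 again, which fits the initial state embedded along [pos 0]. *)
pose U t := kernel_mx (lift_kernel (pos t) (pos t.-1) (u t)).
have final c t : final_state U c (col_of (toC \o embed (pos 0%N) psi)) t =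
    col_of (toC \o embed (pos t) (phase_state pos u c psi t)).
  elim: t => [|t IH] /=.
    rewrite kernel_mx_mul; apply: state_eqP => x.
    by rewrite !amplitude_col_of /= apply_lift_kernel.
  rewrite IH query_embed kernel_mx_mul; apply: state_eqP => x.
  by rewrite !amplitude_col_of /= apply_lift_kernel.
have prob p (f : Z -> R) (A : pred Z) :
    measure_prob (col_of (toC \o embed p f)) [pred x | A (enum_val x.2)]
    = toC (\sum_(z | A z) f z ^+ 2).
  rewrite -(sum_embed p) rmorph_sum; apply: eq_bigr => x _.
  by rewrite mxE enum_rankK; exact: real_complex_norm.
exists w, (col_of (toC \o embed (pos 0%N) psi)), U, (fun x => out (enum_val x.2)); split.
- by rewrite (prob _ _ predT) psi1 rmorph1.
- by move=> t; apply: kernel_mx_unitary; exact: lift_kernel_orthogonal.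
- move=> c cC; rewrite final (prob _ _ (fun z => out z == c)).
  rewrite (_ : 2 / 3 = toC (2 / 3)) ?lecR ?learns //.
  by rewrite rmorphM fmorphV !rmorph_nat.
Qed.

End PhaseAlgorithm.

(** * Exact Grover search *)

Lemma sin_le_self (R : realType) (x : R) : 0 <= x -> sin x <= x.
Proof.
rewrite le_eqVlt => /predU1P[<-|x_gt0]; first by rewrite sin0.
have [|c _] := MVT x_gt0 (fun y _ => is_derive_sin y).
  by apply/continuous_subspaceT => y; exact: continuous_sin.
rewrite sin0 !subr0 => ->; rewrite ler_piMl ?cos_le1 // ltW //.
Qed.

Section GroverAngle.
Variables (R : realType) (m : nat).
(** Starting at [theta], [m.+1] rotations by [2 * theta] end exactly at a right angle. *)
Definition grover_angle : R := pi / (2 * (2 * m.+1%:R + 1)).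
Local Notation theta := grover_angle.

Lemma grover_angle_pihalf : (2 * m.+1%:R + 1) * theta = pi / 2.
Proof.
by rewrite /grover_angle; field.
Qed.

Lemma grover_angle_gt0 : 0 < theta.
Proof.
by rewrite /grover_angle divr_gt0 ?pi_gt0 // mulr_gt0.
Qed.

Lemma cos_grover_angle_gt0 : 0 < cos theta.
Proof.
apply: cos_gt0_pihalf; have := grover_angle_gt0 => th_gt0.
have := grover_angle_pihalf; have : 1 <= m.+1%:R :> R by rewrite ler1n.
move=> m1 th; apply/andP; split; first by have := pi_gt0 R; lra.
rewrite -th; nra.
Qed.

(** This keeps the radicand in [grover_init] nonnegative. *)
Lemma sin_grover_angle : m.+1%:R * sin theta <= 1.
Proof.
have m1 : 1 <= m.+1%:R :> R by rewrite ler1n.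
apply: le_trans (_ : m.+1%:R * theta <= _).
  by rewrite ler_wpM2l // sin_le_self // ltW // grover_angle_gt0.
have /andP[_ pi2] := pihalf_02 R; have := grover_angle_pihalf.
have := grover_angle_gt0; move: pi2 m1; set p := pi / 2; set M := m.+1%:R.
by move=> *; nra.
Qed.

End GroverAngle.

(** * Tensor products of orthogonal kernels *)

Section Tensor.
Variable (R : comPzRingType).

Definition delta (X : eqType) (x y : X) : R := (x == y)%:R.

Lemma delta_orthogonal (X : finType) : orthogonal_kernel (@delta X).
Proof.
move=> x x'; rewrite (bigD1 x) //= big1 ?addr0 => [|y yx].
  by rewrite /delta eqxx mul1r eq_sym.
by rewrite /delta eq_sym (negPf yx) mul0r.
Qed.

Lemma apply_delta (X : finType) (f : X -> R) : kernel_apply (@delta X) f =1 f.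
Proof.
move=> x; rewrite /kernel_apply (bigD1 x) //= big1 ?addr0 => [|y yx].
  by rewrite /delta eqxx mul1r.
by rewrite /delta eq_sym (negPf yx) mul0r.
Qed.

Definition tensor (X Y : finType) (k : X -> X -> R) (l : Y -> Y -> R)
    (z z' : X * Y) : R := k z.1 z'.1 * l z.2 z'.2.

Lemma apply_tensor (X Y : finType) (k : X -> X -> R) (l : Y -> Y -> R) f z :
  kernel_apply (tensor k l) f z =
  kernel_apply k (fun x => kernel_apply l (fun y => f (x, y)) z.2) z.1.
Proof.
rewrite /kernel_apply; under [RHS]eq_bigr do rewrite mulr_sumr.
by rewrite pair_bigA; apply: eq_bigr => -[x y] _; rewrite /tensor /= mulrA.
Qed.

Lemma tensor_orthogonal (X Y : finType) (k : X -> X -> R) (l : Y -> Y -> R) :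
  orthogonal_kernel k -> orthogonal_kernel l -> orthogonal_kernel (tensor k l).
Proof.
move=> k_orth l_orth [x y] [x' y'].
transitivity (\sum_x1 \sum_y1 (k x x1 * k x' x1) * (l y y1 * l y' y1)).
  by rewrite pair_bigA; apply: eq_bigr => -[x1 y1] _; rewrite /tensor /=; ring.
under eq_bigr do rewrite -mulr_sumr l_orth.
by rewrite -mulr_suml k_orth -natrM mulnb xpair_eqE.
Qed.

End Tensor.

Section Grover.
Variables (R : realType) (W : finType) (m : nat).
Hypothesis cardW : #|W| = (m.+1 ^ 2)%N.
Local Notation theta := (grover_angle R m).

(* [None] is a dummy item on which no query is made; its amplitude is tuned so
   that [m.+1] iterations reach the marked item exactly. *)
Definition grover_init (g : option W) : R :=
  if g is Some _ then sin theta else Num.sqrt (1 - #|W|%:R * sin theta ^+ 2).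

Lemma sum_grover_init : \sum_g grover_init g ^+ 2 = 1.
Proof.
rewrite (bigD1 None) //= sqr_sqrtr; last first.
  have := sin_grover_angle R m => le1.
  rewrite cardW natrX -exprMn subr_ge0 expr_le1 // mulr_ge0 //.
  apply: sin_ge0_pi; rewrite ltW ?grover_angle_gt0 //=.
  have := grover_angle_pihalf R m; have : 1 <= m.+1%:R :> R by rewrite ler1n.
  by have := pi_gt0 R; have := grover_angle_gt0 R m; nra.
rewrite (reindex_omap Some id) /=; last by case.
rewrite (eq_bigr (fun=> sin theta ^+ 2)) // (eq_bigl [in W]) => [|w]; last by rewrite eqxx.
by rewrite sumr_const mulr_natl subrK.
Qed.

(** The reflection about [grover_init]. *)
Definition diffusion (g g' : option W) : R :=
  2 * grover_init g * grover_init g' - (g == g')%:R.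

Lemma diffusion_orthogonal : orthogonal_kernel diffusion.
Proof.
move=> g g'; set s := grover_init.
transitivity (\sum_y (4 * s g * s g' * s y ^+ 2 - 2 * s g * ((g' == y)%:R * s y)
   - 2 * s g' * ((g == y)%:R * s y) + delta R g y * delta R g' y)).
  by apply: eq_bigr => y _; rewrite /diffusion /delta -/s; ring.
have deltaE x : \sum_y (x == y)%:R * s y = s x by exact: (apply_delta s x).
rewrite big_split !sumrB -!mulr_sumr sum_grover_init !deltaE /=.
by have -> := delta_orthogonal R g g'; ring.
Qed.

(** Closed form after [t] iterations: a unit vector at angle [(2 * t + 1) * theta] in the plane of
    the marked item and the rest of [grover_init], whose norm is [cos theta]. *)
Definition grover_state (t : nat) (w : W) (g : option W) : R :=
  if g == Some w then sin ((2 * t%:R + 1) * theta)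
  else cos ((2 * t%:R + 1) * theta) / cos theta * grover_init g.

Lemma grover_state0 w : grover_state 0 w =1 grover_init.
Proof.
move=> g; rewrite /grover_state mulr0 add0r mul1r; case: eqP => [->//|_].
by rewrite divff ?mul1r // lt0r_neq0 // cos_grover_angle_gt0.
Qed.

Lemma grover_state_last w g : grover_state m.+1 w g = (g == Some w)%:R.
Proof.
rewrite /grover_state grover_angle_pihalf sin_pihalf cos_pihalf mul0r mul0r.
by case: eqP.
Qed.

Lemma grover_step t w :
  kernel_apply diffusion (fun g => (-1) ^+ (g == Some w) * grover_state t w g)
    =1 grover_state t.+1 w.
Proof.
have cos_neq0 : cos theta != 0 by rewrite lt0r_neq0 // cos_grover_angle_gt0.
set A := (2 * t%:R + 1) * theta.
have A1 : (2 * t.+1%:R + 1) * theta = A + theta + theta by rewrite /A -natr1; ring.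
pose h g := (-1) ^+ (g == Some w) * grover_state t w g.
(* After the sign flip the state sits at angle [- A], and [grover_init] at angle [theta]. *)
have overlap : \sum_g grover_init g * h g = cos (A + theta).
  rewrite (bigD1 (Some w)) //= /h /grover_state eqxx -/A expr1.
  rewrite (eq_bigr (fun g => cos A / cos theta * grover_init g ^+ 2)); last first.
    by move=> g /negPf ->; rewrite expr0 mul1r; ring.
  have := sum_grover_init; rewrite (bigD1 (Some w)) //= => /(canRL (addKr _)) sumE.
  rewrite -mulr_sumr sumE cosD.
  have -> : - sin theta ^+ 2 + 1 = cos theta ^+ 2.
    by rewrite -(cos2Dsin2 theta); ring.
  by field.
move=> g; have -> : kernel_apply diffusion h g = 2 * grover_init g * cos (A + theta) - h g.
  rewrite -overlap mulr_sumr -[X in _ - X](apply_delta h) -sumrB.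
  by apply: eq_bigr => y _; rewrite /diffusion /delta; ring.
rewrite /h /grover_state A1 -/A; set B := A + theta.
have AE : A = B - theta by rewrite /B addrK.
clearbody B; rewrite AE; case: eqP => [->|_] /=.
  by rewrite expr1 sinB sinD; ring.
by rewrite expr0 mul1r cosB cosD; field.
Qed.

End Grover.

(** * The quantum learner *)

Section Kernels.
Variable R : realType.

Lemma eq_apply (X : finType) (u : X -> X -> R) (f f' : X -> R) :
  f =1 f' -> kernel_apply u f =1 kernel_apply u f'.
Proof. by move=> ff' x; apply: eq_bigr => y _; rewrite ff'. Qed.

Lemma apply_scale (X : finType) (u : X -> X -> R) (a : R) (f : X -> R) x :
  kernel_apply u (fun y => a * f y) x = a * kernel_apply u f x.
Proof. by rewrite /kernel_apply mulr_sumr; apply: eq_bigr => y _; ring. Qed.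

Section Lift.
Variables X G A : finType.
Local Notation d := (@delta R _).

Lemma apply_tensor1 (k : X -> X -> R) f x (g : G) (b : A) :
  kernel_apply (tensor (tensor k d) d) f (x, g, b) =
  kernel_apply k (fun y => f (y, g, b)) x.
Proof.
rewrite !apply_tensor /=; apply: eq_apply => y.
by rewrite apply_delta apply_delta.
Qed.

Lemma apply_tensor2 (k : G -> G -> R) f (x : X) g (b : A) :
  kernel_apply (tensor (tensor d k) d) f (x, g, b) =
  kernel_apply k (fun y => f (x, y, b)) g.
Proof.
rewrite !apply_tensor /= apply_delta; apply: eq_apply => y.
by rewrite apply_delta.
Qed.

Lemma apply_tensor3 (k : A -> A -> R) f (x : X) (g : G) b :
  kernel_apply (tensor (tensor d d) k) f (x, g, b) =
  kernel_apply k (fun y => f (x, g, y)) b.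
Proof. by rewrite !apply_tensor /= apply_delta apply_delta. Qed.

End Lift.

Lemma orthogonal_parseval (X : finType) (u : X -> X -> R) (f : X -> R) :
  orthogonal_kernel u -> \sum_y (\sum_x u x y * f x) ^+ 2 = \sum_x f x ^+ 2.
Proof.
move=> u_orth.
transitivity (\sum_x \sum_x' (x == x')%:R * (f x * f x')); last first.
  apply: eq_bigr => x _; rewrite (bigD1 x) //= eqxx mul1r big1 ?addr0 //.
  by move=> x' xx'; rewrite eq_sym (negPf xx') mul0r.
under eq_bigr do rewrite expr2 big_distrlr.
rewrite exchange_big; apply: eq_bigr => x _ /=.
rewrite exchange_big; apply: eq_bigr => x' _ /=.
by rewrite -u_orth mulr_suml; apply: eq_bigr => y _; ring.
Qed.

Definition fourier (V : finType) (b : V -> V -> bool) (x y : V) : R :=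
  (-1) ^+ b x y / Num.sqrt #|V|%:R.

Lemma sum_inv_card (V : finType) : (0 < #|V|)%N -> \sum_(x : V) #|V|%:R^-1 = 1 :> R.
Proof.
move=> V_gt0; rewrite (eq_bigl [in V]) // sumr_const -[LHS]mulr_natl divff //.
by rewrite pnatr_eq0 -lt0n.
Qed.

(** In the applications [h] is a translation by an element on which two distinct characters differ;
    it negates their product, so the sum equals its own opposite. *)
Lemma fourier_orthogonal (V : finType) (b : V -> V -> bool) : (0 < #|V|)%N ->
  (forall x x', x != x' -> exists2 h : V -> V, injective h &
     forall y, b x (h y) (+) b x' (h y) = ~~ (b x y (+) b x' y)) ->
  orthogonal_kernel (fourier b).
Proof.
move=> V_gt0 shift x x'.
have fE y : fourier b x y * fourier b x' y = (-1) ^+ (b x y (+) b x' y) / #|V|%:R.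
  by rewrite /fourier mulrACA signr_addb -invfM -expr2 sqr_sqrtr.
under eq_bigr do rewrite fE.
have [->|xx'] := eqVneq x x'.
  by under eq_bigr do rewrite addbb expr0 mul1r; exact: sum_inv_card.
have [h h_inj hE] := shift x x' xx'; rewrite -mulr_suml.
set s := \sum_y _; suff : s = - s by move=> sN; have -> : s = 0; [lra | rewrite mul0r].
rewrite {1}/s (reindex_inj h_inj) -sumrN; apply: eq_bigr => y _.
by rewrite hE signrN.
Qed.

End Kernels.

(** * The circuit and its success probability *)

Section Learner.
Variables (R : realType) (F : finFieldType) (W : finType).
Variables (lam : F -> bool) (pi : F -> W) (m : nat).
Hypothesis lamD : {morph lam : x y / x + y >-> x (+) y}.
Hypothesis lam_neq0 : exists x, lam x.
Hypothesis cardW : #|W| = (m.+1 ^ 2)%N.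
Hypothesis m_ge2 : (2 <= m)%N.
Hypothesis pi_bal :
  forall w, #|[set v | pi v == w]|%:R / #|F|%:R = #|W|%:R^-1 :> R.

Local Notation D := m.+1.
Local Notation A := {ffun 'I_D -> F}.
Local Notation q := (#|F|%:R : R).
Local Notation position := (position F W D).

Let F_gt0 : (0 < #|F|)%N. Proof. by apply/card_gt0P; exists 0. Qed.
Let A_gt0 : (0 < #|{: A}|)%N. Proof. by apply/card_gt0P; exists 0. Qed.
Let FF_gt0 : (0 < #|{: F * F}|)%N. Proof. by rewrite card_prod muln_gt0 F_gt0. Qed.

Definition bit1 (x y : F) : bool := lam (x * y).
Definition bit2 (x y : F * F) : bool := lam (x.1 * y.1 + x.2 * y.2).
Definition bitD (x y : A) : bool := lam (\sum_j x j * y j).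

Lemma lam_shift (d : F) : d != 0 -> exists x, lam (d * x).
Proof. by have [t tP] := lam_neq0; exists (d^-1 * t); rewrite mulVKf. Qed.

Lemma lamB x y : lam (x - y) = lam x (+) lam y.
Proof. by rewrite lamD (lamN lamD). Qed.

Lemma fourier1_orthogonal : orthogonal_kernel (fourier R bit1).
Proof.
apply: fourier_orthogonal => // x x'; rewrite -subr_eq0 => /lam_shift[t tP].
exists (fun y => y + t); first exact: addIr.
move=> y; rewrite /bit1 -!lamB -!mulrBl mulrDr lamD tP addbT //.
Qed.

Lemma fourier2_orthogonal : orthogonal_kernel (fourier R bit2).
Proof.
apply: fourier_orthogonal => // -[x1 x2] [x1' x2'] xx'.
have [t tP] : exists t : F * F, lam ((x1 - x1') * t.1 + (x2 - x2') * t.2).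
  have [e1|n1] := eqVneq x1 x1'; last first.
    have [|t tP] := @lam_shift (x1 - x1'); first by rewrite subr_eq0.
    by exists (t, 0); rewrite mulr0 addr0.
  have [|t tP] := @lam_shift (x2 - x2').
    by rewrite subr_eq0; apply: contraNneq xx' => ->; rewrite e1.
  by exists (0, t); rewrite mulr0 add0r.
exists (fun y => (y.1 + t.1, y.2 + t.2)).
  by move=> [y1 y2] [y1' y2'] /= [/addIr-> /addIr->].
move=> y; rewrite /bit2 /= -!lamB.
have -> : x1 * (y.1 + t.1) + x2 * (y.2 + t.2) - (x1' * (y.1 + t.1) + x2' * (y.2 + t.2))
   = (x1 * y.1 + x2 * y.2 - (x1' * y.1 + x2' * y.2)) + ((x1 - x1') * t.1 + (x2 - x2') * t.2).
  by ring.
by rewrite lamD tP addbT.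
Qed.

Lemma fourierD_orthogonal : orthogonal_kernel (fourier R bitD).
Proof.
apply: fourier_orthogonal => // x x' xx'.
have [j xj] : exists j, x j - x' j != 0.
  apply/existsP; apply: contraNT xx'; rewrite negb_exists => /forallP eqx.
  by apply/eqP/ffunP => j; apply/eqP; rewrite -subr_eq0; have := eqx j; rewrite negbK.
have [t tP] := lam_shift xj.
exists (fun y : A => [ffun i => y i + (i == j)%:R * t] : A).
  by move=> y y' /ffunP eqy; apply/ffunP => i; have := eqy i; rewrite !ffunE => /addIr.
move=> y; rewrite /bitD -!lamB -!sumrB.
rewrite (eq_bigr (fun i => (x i * y i - x' i * y i) + (i == j)%:R * ((x i - x' i) * t))).
  have sumE : \sum_i (i == j)%:R * ((x i - x' i) * t) = (x j - x' j) * t.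
    rewrite (bigD1 j) //= eqxx mul1r big1 ?addr0 // => i /negPf->.
    by rewrite mul0r.
  by rewrite big_split /= lamD sumE tP addbT.
by move=> i _; rewrite ffunE; ring.
Qed.

Local Notation Z := ((F * F * option W) * A)%type.

(** Every concept is false here because [lam 0] is, so querying it does nothing. *)
Definition null_position : position := inr (0, ord0, 0).

(** Queries [0] to [D - 1] serve Grover search, and query [D] is idle since the model puts a query
    between any two kernels. The last [D] read the second table at the ratio of the transformed
    coordinates, one coefficient each. *)
Definition learner_query (t : nat) (z : Z) : position :=
  if (t < D)%N then if z.1.2 is Some w then inl (z.1.1, w) else null_position
  else if t == D then null_position
  else inr (z.1.1.1 / z.1.1.2, inord (t - D.+1), z.2 (inord (t - D.+1))).

Definition learner_kernel (t : nat) : Z -> Z -> R :=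
  if t == 0 then @delta R _
  else if (t <= D)%N then tensor (tensor (@delta R _) (@diffusion R W m)) (@delta R _)
  else if t == D.+1 then tensor (tensor (fourier R bit2) (@delta R _)) (@delta R _)
  else if t == (D.+1 + D)%N then tensor (tensor (@delta R _) (@delta R _)) (fourier R bitD)
  else @delta R _.

Lemma learner_kernel_orthogonal t : orthogonal_kernel (learner_kernel t).
Proof.
rewrite /learner_kernel; case: ifP => _; first exact: delta_orthogonal.
case: ifP => _.
  do 2?apply: tensor_orthogonal; try exact: delta_orthogonal.
  exact: diffusion_orthogonal.
case: ifP => _.
  do 2?apply: tensor_orthogonal; try exact: delta_orthogonal.
  exact: fourier2_orthogonal.
case: ifP => _; last exact: delta_orthogonal.
do 2?apply: tensor_orthogonal; try exact: delta_orthogonal.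
exact: fourierD_orthogonal.
Qed.

Let c2 : R := (Num.sqrt #|{: F * F}|%:R)^-1.
Let cD : R := (Num.sqrt #|{: A}|%:R)^-1.

Definition learner_init (z : Z) : R := c2 * grover_init R m z.1.2 * cD.

Lemma sum_learner_init : \sum_z learner_init z ^+ 2 = 1.
Proof.
rewrite sum_triple (eq_bigr (fun=> #|{: A}|%:R^-1)) ?sum_inv_card // => b _.
rewrite -[RHS]mul1r -[X in X * _](sum_grover_init R cardW) mulr_suml; apply: eq_bigr => g _.
rewrite -[RHS]mul1r -[X in X * _](sum_inv_card R FF_gt0) mulr_suml; apply: eq_bigr => x _.
by rewrite /learner_init !exprMn /c2 /cD !exprVn !sqr_sqrtr // /=; ring.
Qed.

Section Run.
Variables (k : F) (a : A).

Definition location (p : F * F) : W := pi (monic_eval a (line k p)).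

Let st (t : nat) : Z -> R :=
  phase_state (fun t z => enum_rank (learner_query t z)) learner_kernel
    (hidden_concept lam pi k a) learner_init t.

Lemma stS t : st t.+1 = kernel_apply (learner_kernel t.+1)
  (fun z => (-1) ^+ hidden_bit lam pi k a (learner_query t z) * st t z).
Proof.
rewrite /st /=; congr kernel_apply; apply: funext => z.
by rewrite ffunE enum_rankK.
Qed.

Lemma hidden_bit_null : hidden_bit lam pi k a null_position = false.
Proof. by rewrite /= mul0r (lam0 lamD) andbF. Qed.

Lemma st_grover t x g b : (t <= D)%N ->
  st t (x, g, b) = c2 * cD * grover_state R m t (location x) g.
Proof.
elim: t x g b => [|t IH] x g b tD.
  by rewrite /st /= /learner_kernel eqxx apply_delta grover_state0 /learner_init /=; ring.
rewrite stS /learner_kernel /= tD apply_tensor2 -(grover_step R cardW) -apply_scale.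
apply: eq_apply => g'; rewrite IH; last exact: ltnW.
rewrite /learner_query tD mulrCA; congr (_ * (_ ^+ _ * _)); case: g' => [w|] /=.
  by rewrite eq_sym.
by rewrite mul0r (lam0 lamD) andbF.
Qed.

Definition spectrum (x : F * F) (g : option W) : R :=
  kernel_apply (fourier R bit2) (fun y => c2 * (g == Some (location y))%:R) x.

Lemma st_fourier x g b : st D.+1 (x, g, b) = cD * spectrum x g.
Proof.
rewrite stS /learner_kernel /= ltnn eqxx apply_tensor1 /spectrum -apply_scale.
apply: eq_apply => y; rewrite st_grover // grover_state_last /learner_query ltnn eqxx.
by rewrite hidden_bit_null expr0 mul1r; ring.
Qed.

Definition key_sign (x : F * F) (b : A) (i : nat) : R :=
  (-1) ^+ ((x.1 / x.2 == k) && lam (b (inord i) * a (inord i))).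

Lemma st_keys j x g b : (j < D)%N ->
  st (D.+1 + j) (x, g, b) = cD * spectrum x g * \prod_(0 <= i < j) key_sign x b i.
Proof.
elim: j => [|j IH] jD; first by rewrite addn0 st_fourier big_geq // mulr1.
rewrite addnS stS /learner_kernel /= ifF; last lia.
rewrite ifF; last lia.
rewrite ifF; last lia.
rewrite apply_delta IH ?(ltnW jD) // big_nat_recr //= /learner_query ifF; last lia.
rewrite ifF; last lia.
rewrite (_ : D.+1 + j - D.+1 = j)%N; last lia.
by rewrite /= mulrC -!mulrA.
Qed.

(** At the right key the accumulated signs form the character of [a], which the Fourier transform
    concentrates on [a], as in Bernstein-Vazirani. *)
Lemma st_final x g : x.1 / x.2 = k -> st (D.+1 + D) (x, g, a) = spectrum x g.
Proof.
move=> xk; rewrite [X in st X](addnS D.+1 m) stS /learner_kernel /= ifF; last lia.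
rewrite ifF; last lia.
rewrite ifT; last by rewrite addnS.
rewrite apply_tensor3 /kernel_apply.
rewrite -[RHS]mul1r -[X in X * _](sum_inv_card R A_gt0) mulr_suml; apply: eq_bigr => b _.
rewrite st_keys // /learner_query ifF; last lia.
rewrite ifF; last lia.
rewrite (_ : D.+1 + m - D.+1 = m)%N; last lia.
have signD : {morph (fun y : F => (-1) ^+ lam y : R) : y z / y + z >-> y * z}.
  by move=> y z; rewrite lamD signr_addb.
have sgn : (-1) ^+ bitD a b = \prod_(0 <= i < D) key_sign x b i.
  rewrite big_mkord /bitD (big_morph _ signD (_ : _ = 1)); last first.
    by rewrite (lam0 lamD).
  by apply: eq_bigr => i _; rewrite /key_sign inord_val xk eqxx mulrC.
have sqr_sgn := sqrr_sign R (bitD a b); move: sqr_sgn.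
rewrite /fourier sgn big_nat_recr //= {2}/key_sign xk eqxx /= => sqr_sgn.
have cDE : cD ^+ 2 = #|{: A}|%:R^-1 by rewrite /cD exprVn sqr_sqrtr.
rewrite -cDE -[X in _ / X]invrK -/cD -[RHS]mul1r -[X in _ = X * _]sqr_sgn.
by rewrite /key_sign xk eqxx /=; rewrite invrK; ring.
Qed.

(** The marked cell depends on [y + k * x] alone. Substituting for [y] makes the inner sum
    independent of [x], and a one-dimensional transform of a fiber remains. *)
Lemma spectrum_line v w : spectrum (k * v, v) (Some w) =
  (Num.sqrt q)^-1 * \sum_z fourier R bit1 z v * (pi (monic_eval a z) == w)%:R.
Proof.
have sqrt_q : (Num.sqrt q)^-1 ^+ 2 = q^-1 by rewrite exprVn sqr_sqrtr.
have c2E : c2 ^+ 2 = q^-1 ^+ 2.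
  by rewrite /c2 [LHS]exprVn sqr_sqrtr // card_prod natrM -expr2 exprVn.
have q_neq0 : q != 0 by rewrite pnatr_eq0 -lt0n.
pose S := \sum_z (-1) ^+ lam (v * z) * (pi (monic_eval a z) == w)%:R : R.
transitivity (c2 ^+ 2 * (q * S)).
  rewrite /spectrum /kernel_apply /fourier -/c2.
  transitivity (\sum_(x : F) \sum_(y : F) c2 ^+ 2 * ((-1) ^+ lam (v * (y + k * x))
      * (pi (monic_eval a (y + k * x)) == w)%:R)).
    rewrite pair_bigA; apply: eq_bigr => -[x y] _; rewrite /bit2 /location /line /=.
    rewrite (_ : k * v * x + v * y = v * (y + k * x)); last by ring.
    by rewrite (_ : (Some w == Some _) = (pi (monic_eval a (y + k * x)) == w)) 1?eq_sym //; ring.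
  have inner x : \sum_y c2 ^+ 2 * ((-1) ^+ lam (v * (y + k * x))
      * (pi (monic_eval a (y + k * x)) == w)%:R) = c2 ^+ 2 * S.
    rewrite -mulr_sumr /S (reindex_inj (addIr (- (k * x)))) /=; congr (_ * _).
    by apply: eq_bigr => y _; rewrite subrK.
  under eq_bigr do rewrite inner.
  rewrite (eq_bigl [in F]) // sumr_const -[LHS]mulr_natl; ring.
rewrite c2E mulr_sumr /S !mulr_sumr; apply: eq_bigr => z _.
rewrite /fourier /bit1 (mulrC z) expr2.
rewrite (_ : (Num.sqrt q)^-1 * _ = (Num.sqrt q)^-1 ^+ 2
  * ((-1) ^+ lam (v * z) * (pi (monic_eval a z) == w)%:R)); last by ring.
by rewrite sqrt_q; field.
Qed.

Definition fiber (w : W) : {set F} := [set z | pi (monic_eval a z) == w].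

Lemma fiber_le w : #|fiber w|%:R / q <= D%:R^-1 :> R.
Proof.
have card_le : (#|fiber w| <= #|[set v | pi v == w]| * D)%N.
  rewrite -sum1_card (partition_big (monic_eval a) (fun v => v \in [set v | pi v == w])) /=.
    rewrite -sum_nat_const; apply: leq_sum => v _.
    rewrite sum1dep_card; apply: leq_trans (monic_eval_roots a v (ltn0Sn m)).
    by apply: subset_leq_card; apply/fintype.subsetP => z; rewrite !inE => /andP[].
  by move=> z; rewrite !inE.
apply: le_trans (_ : #|[set v | pi v == w]|%:R / q * D%:R <= _).
  by rewrite mulrAC ler_wpM2r ?invr_ge0 // -natrM ler_nat.
by rewrite pi_bal cardW natrX expr2 invfM -mulrA mulVf ?mulr1 //.
Qed.

Lemma spectrum_success :
  2 / 3 <= \sum_(v | v != 0) \sum_w spectrum (k * v, v) (Some w) ^+ 2.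
Proof.
have q_neq0 : q != 0 by rewrite pnatr_eq0 -lt0n.
have sqrt_q : (Num.sqrt q)^-1 ^+ 2 = q^-1 by rewrite exprVn sqr_sqrtr.
have count (z : F) : \sum_w (pi (monic_eval a z) == w)%:R = 1 :> R.
  rewrite (bigD1 (pi (monic_eval a z))) //= eqxx big1 ?addr0 // => w.
  by rewrite eq_sym => /negPf->.
have sum_fiber w : \sum_z (pi (monic_eval a z) == w)%:R = #|fiber w|%:R :> R.
  by rewrite -sum1_card natr_sum [RHS]big_mkcond; apply: eq_bigr => z _; rewrite inE; case: eqP.
have sum_fibers : \sum_w #|fiber w|%:R = q.
  under eq_bigr do rewrite -sum_fiber.
  rewrite exchange_big /= (eq_bigr (fun=> 1)) // (eq_bigl [in F]) // sumr_const.
  by [].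
have total : \sum_v \sum_w spectrum (k * v, v) (Some w) ^+ 2 = 1.
  rewrite exchange_big /=.
  rewrite (eq_bigr (fun w => q^-1 * #|fiber w|%:R)) => [|w _].
    by rewrite -mulr_sumr sum_fibers mulVf.
  under eq_bigr do rewrite spectrum_line exprMn sqrt_q.
  rewrite -mulr_sumr (orthogonal_parseval _ fourier1_orthogonal) -sum_fiber.
  by congr (_ * _); apply: eq_bigr => z _; case: eqP; rewrite ?expr1n ?expr0n.
have zero : \sum_w spectrum (k * 0, 0) (Some w) ^+ 2 <= 3^-1.
  apply: le_trans (_ : \sum_w #|fiber w|%:R / q * D%:R^-1 <= _).
    apply: ler_sum => w _; rewrite spectrum_line /fourier /bit1.
    rewrite (eq_bigr (fun z => (Num.sqrt q)^-1 * (pi (monic_eval a z) == w)%:R)).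
      rewrite -mulr_sumr mulrA -expr2 sqrt_q sum_fiber mulrC expr2.
      by rewrite ler_wpM2l ?fiber_le // divr_ge0.
    by move=> z _; rewrite mulr0 (lam0 lamD) expr0 mul1r.
  rewrite -mulr_suml -mulr_suml sum_fibers divff // mul1r.
  by rewrite lef_pV2 ?posrE ?ltr0n // ler_nat.
by move: total; rewrite (bigD1 0) //=; move: zero; lra.
Qed.

End Run.

Lemma ler_sum_inj (I J : finType) (P : pred I) (Q : pred J) (h : I -> J) (f : J -> R) :
  {in P &, injective h} -> (forall i, P i -> Q (h i)) -> (forall j, 0 <= f j) ->
  \sum_(i | P i) f (h i) <= \sum_(j | Q j) f j.
Proof.
move=> h_inj PQ f_ge0; rewrite -(big_imset f h_inj) /=.
rewrite big_mkcond [leRHS]big_mkcond; apply: ler_sum => j _.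
case: ifP => [/imsetP[i Pi ->]|_]; first by rewrite PQ.
by case: ifP.
Qed.

Lemma hidden_quantum_learnable :
  quantum_learnable R (hidden_class lam pi D) (D.+1 + D).
Proof.
apply: (phase_learnable (enum_rank null_position)
  (pos := fun t z => enum_rank (learner_query t z)) (u := learner_kernel) (psi := learner_init)
  (out := fun z => hidden_concept lam pi (z.1.1.1 / z.1.1.2) z.2)).
- exact: sum_learner_init.
- exact: learner_kernel_orthogonal.
- move=> _ /imsetP[[k a] _ ->]; set st := phase_state _ _ _ _ _.
  apply: le_trans (spectrum_success k a) _; rewrite pair_big /=.
  pose h (p : F * W) : Z := (k * p.1, p.1, Some p.2, a).
  have divk (p : F * W) : p.1 != 0 -> k * p.1 / p.1 = k by move=> p0; rewrite mulfK.
  rewrite (eq_bigr (fun p => st (h p) ^+ 2)) => [|p]; last first.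
    rewrite andbT => p0.
    by rewrite /st /h (st_final (x := (k * p.1, p.1)) a (Some p.2) (divk p p0)).
  apply: ler_sum_inj => [[v w] [v' w'] _ _ []|p|z]; last exact: sqr_ge0.
    by move=> _ -> ->.
  by rewrite andbT => p0; rewrite /= divk.
Qed.

End Learner.

(** * The gap *)

Lemma leastP (P : nat -> Prop) : (exists n, P n) ->
  P (least P) /\ forall m, P m -> (least P <= m)%N.
Proof.
move=> [n Pn].
have exP : exists n, `[< P n >] by exists n; apply/asboolP.
have [m /asboolP Pm m_min] := ex_minnP exP.
apply: (@xgetPex _ 0%N [set n | P n /\ forall m, P m -> (n <= m)%N]%classic).
by exists m; split=> // j /asboolP; exact: m_min.
Qed.

Fixpoint query_all (N : nat) (s : seq 'I_N) (f : concept N) : decision_tree N :=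
  if s is i :: s' then
    Query i (fun b => query_all s' [ffun j => if j == i then b else f j])
  else Output f.

Lemma run_query_all N (s : seq 'I_N) f c j :
  run (query_all s f) c j = if j \in s then c j else f j.
Proof.
elim: s f => //= i s IH f; rewrite IH ffunE inE.
by case: (j \in s); rewrite ?orbT ?orbF //; case: eqP => [->|].
Qed.

Lemma randomized_learnable_exists (R : realType) (N : nat) (C : concept_class N) :
  exists T, randomized_learnable R C T.
Proof.
pose t := query_all (enum 'I_N) [ffun=> false].
exists (depth t), 1%N, (fun=> 1), (fun=> t); split=> //.
  by rewrite big_ord1.
move=> c _; rewrite big_mkcond big_ord1.
have -> : run t c = c by apply/ffunP => j; rewrite run_query_all mem_enum.
by rewrite eqxx; lra.
Qed.

Lemma exists_balanced_map (F W U : finType) : #|F| = (#|W| * #|U|)%N ->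
  exists pi : F -> W, forall w, #|[set v | pi v == w]| = #|U|.
Proof.
rewrite -card_prod => cardF.
pose g (v : F) : W * U := enum_val (cast_ord cardF (enum_rank v)).
have g_bij : bijective g.
  exists (fun p => enum_val (cast_ord (esym cardF) (enum_rank p))) => [v|p].
    by rewrite /g enum_valK cast_ordK enum_rankK.
  by rewrite /g enum_valK cast_ordKV enum_rankK.
exists (fun v => (g v).1) => w.
rewrite -[#|U|]mul1n -(cards1 w) -cardsT -cardsX.
rewrite -(on_card_preimset (onW_bij (finset.setX [set w] [set: U]) g_bij)).
by apply: eq_card => v; rewrite !inE andbT.
Qed.

Lemma hidden_class_exists (R : realType) (k m : nat) : m.+1 = (2 ^ (k + 5))%N ->
  exists NC : {N : nat & concept_class N},
    [/\ (0 < projT1 NC <= m.+1 ^ 19)%N,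
        quantum_learnable R (projT2 NC) (m.+2 + m.+1),
        forall T, quantum_learnable R (projT2 NC) T -> (m.+1 <= 5 * T)%N
      & forall T, randomized_learnable R (projT2 NC) T -> ((2 ^ (k + 3)) ^ 3 < T)%N].
Proof.
set D := m.+1 => DE.
have D_ge32 : (32 <= D)%N.
  by rewrite DE -[32%N]/(2 ^ 5)%N leq_pexp2l // leq_addl.
have D_gt0 : (0 < D)%N by [].
have Du : D = (4 * 2 ^ (k + 3))%N.
  by rewrite DE -[4%N]/(2 ^ 2)%N -expnD; congr (_ ^ _)%N; lia.
have [F F_char cardF0] := pPrimePowerField (isT : prime 2) (isT : (0 < ((k + 5) * 8).-1.+1)%N).
have cardF : #|F| = (D ^ 8)%N.
  by rewrite cardF0 DE -expnM; congr (_ ^ _)%N; lia.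
have [lam [lamD lam_neq0]] := exists_additive_bit F_char cardF0.
have cardFWU : #|F| = (#|'I_(D ^ 2)| * #|'I_(D ^ 6)|)%N by rewrite !card_ord -expnD.
have [pi pi_card] := exists_balanced_map cardFWU.
have pi_bal (w : 'I_(D ^ 2)) :
    #|[set v | pi v == w]|%:R / #|F|%:R = #|'I_(D ^ 2)|%:R^-1 :> R.
  rewrite pi_card cardFWU natrM invfM mulrCA mulfV ?mulr1 //.
  by rewrite pnatr_eq0 card_ord -lt0n expn_gt0 D_gt0.
have leWF : (#|'I_(D ^ 2)| <= #|F|)%N by rewrite card_ord cardF leq_pexp2l.
have leDF : (D <= #|F|)%N by rewrite cardF -{1}(expn1 D) leq_pexp2l.
have W_gt0 : (0 < #|'I_(D ^ 2)|)%N by rewrite card_ord expn_gt0 D_gt0.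
pose N := #|position F 'I_(D ^ 2) D|.
have NE : N = (D ^ 18 + D ^ 17)%N.
  rewrite /N card_sum !card_prod !card_ord cardF -!expnD.
  by rewrite -expnSr -expnD.
have N_le : (N <= D ^ 19)%N.
  rewrite NE [(D ^ 19)%N]expnS [(D ^ 18)%N]expnS; set X := (D ^ 17)%N.
  have : (2 * (D * X) <= D * (D * X))%N by rewrite leq_mul2r (leq_trans _ D_ge32) ?orbT.
  have : (X <= D * X)%N by rewrite leq_pmull.
  lia.
exists (existT _ N (hidden_class lam pi D)); split=> /=.
- by rewrite N_le NE addn_gt0 expn_gt0 D_gt0.
- by apply: (hidden_quantum_learnable lamD lam_neq0) => //; rewrite ?card_ord //; lia.
- move=> T /quantum_learnable_card; rewrite -/N => cardC.
  have cardC_ge : (#|F| ^ D <= #|hidden_class lam pi D|)%N.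
    have inj := @hidden_concept_inj F 'I_(D ^ 2) lam pi D lamD lam_neq0 0.
    rewrite -{1}[D]card_ord -card_ffun -(card_imset _ inj).
    apply: subset_leq_card; apply/fintype.subsetP => _ /imsetP[a _ ->].
    exact: hidden_concept_in.
  have twoN : (2 * N <= D ^ 20)%N.
    by rewrite [(D ^ 20)%N]expnS leq_mul // (leq_trans _ D_ge32).
  have : (D ^ (8 * D) < D ^ (40 * T + 2))%N.
    have powT : (((2 * N) ^ T) ^ 2 <= D ^ (40 * T))%N.
      have [->|T_gt0] := posnP T; first by rewrite muln0.
      rewrite -expnM (_ : (40 * T = 20 * (T * 2))%N); last lia.
      by rewrite [leqRHS]expnM leq_exp2r // muln_gt0 T_gt0.
    rewrite cardF -expnM in cardC_ge; rewrite expnD.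
    have D2 : (3 < 2 * D ^ 2)%N.
      apply: (@leq_trans (2 * 2 ^ 2)) => //.
      by rewrite leq_mul2l leq_sqr (leq_trans _ D_ge32).
    have pow_gt0 : (0 < D ^ (40 * T))%N by rewrite expn_gt0.
    rewrite -(ltn_pmul2l (isT : 0 < 2)%N) mulnCA.
    apply: (@leq_ltn_trans (D ^ (40 * T) * 3)); last by rewrite ltn_pmul2l.
    apply: leq_trans (leq_mul (leqnn 2) cardC_ge) _; apply: leq_trans cardC _.
    by rewrite mulnC leq_mul2r powT orbT.
  by rewrite ltn_exp2l ?(leq_trans _ D_ge32) //; clear; lia.
- move=> T; apply: (randomized_complexity_lower lamD lam_neq0) => //.
  + by rewrite -{1}(expn1 2) leq_pexp2l // addn_gt0 orbT.
  + by rewrite card_ord.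
Qed.

Lemma log2_exp (R : realType) n : log2 (2 ^ n)%:R = n%:R :> R.
Proof.
rewrite /log2 natrX lnXn // -[ln _ *+ n]mulr_natl mulfK // lt0r_neq0 // ln_gt0 //.
by rewrite ltr1n.
Qed.

Lemma ler_log2 (R : realType) (a b : nat) :
  (0 < a <= b)%N -> log2 a%:R <= log2 b%:R :> R.
Proof.
move=> /andP[a_gt0 ab]; rewrite /log2 ler_wpM2r //.
  by rewrite invr_ge0 ln_ge0 // ler1n.
by rewrite ler_ln ?posrE ?ltr0n ?(leq_trans a_gt0) // ler_nat.
Qed.

Lemma gap_arithmetic (R : realType) (c : R) (k Q N : nat) :
  0 <= c -> c * 600 ^+ 2 <= 1 ->
  (2 ^ (k + 2) <= Q)%N -> (Q <= 4 * 2 ^ (k + 5))%N ->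
  (0 < N <= (2 ^ (k + 5)) ^ 19)%N ->
  c * (Q%:R ^+ 3 / log2 Q%:R) * log2 N%:R
    <= ((2 ^ (k + 3)) ^ 3)%:R :> R.
Proof.
move=> c_ge0 c_le Q_ge Q_le N_le.
pose e : R := (k + 5)%:R; pose d : R := (2 ^ (k + 5))%:R.
have e_gt0 : 0 < e by rewrite /e ltr0n addn_gt0 orbT.
have d_ge0 : 0 <= d by [].
have logN : log2 N%:R <= 19 * e.
  by apply: le_trans (ler_log2 R N_le) _; rewrite -expnM log2_exp natrM mulrC.
have logN_ge0 : 0 <= log2 N%:R :> R.
  by case/andP: N_le => N1 _; have := @ler_log2 R 1 N; rewrite N1 (log2_exp R 0); exact.
have logQ : 2 / 5 * e <= log2 Q%:R.
  apply: le_trans (_ : (k + 2)%:R <= _).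
    by rewrite /e !natrD; have : 0 <= k%:R :> R by []; lra.
  by rewrite -(log2_exp R (k + 2)); apply: ler_log2; rewrite expn_gt0 Q_ge.
have logQ_gt0 : 0 < 2 / 5 * e by rewrite mulr_gt0 // divr_gt0.
have Q3 : Q%:R ^+ 3 <= (4 * d) ^+ 3 :> R.
  by rewrite lerXn2r ?nnegrE ?mulr_ge0 // /d -natrM ler_nat.
have ratio : Q%:R ^+ 3 / log2 Q%:R <= (4 * d) ^+ 3 / (2 / 5 * e) :> R.
  apply: ler_pM => //.
    by rewrite invr_ge0 (le_trans _ logQ) // ltW.
  by rewrite lef_pV2 ?posrE // (lt_le_trans logQ_gt0).
have -> : ((2 ^ (k + 3)) ^ 3)%:R = (d / 4) ^+ 3 :> R.
  rewrite natrX; congr (_ ^+ 3); rewrite /d (_ : 2 ^ (k + 5) = 2 ^ (k + 3) * 4)%N.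
    by rewrite natrM mulfK.
  by rewrite -[4%N]/(2 ^ 2)%N -expnD -addnA.
rewrite -mulrA.
apply: le_trans (_ : c * ((4 * d) ^+ 3 / (2 / 5 * e) * (19 * e)) <= _).
  rewrite ler_wpM2l // ler_pM //.
  by rewrite divr_ge0 ?exprn_ge0 // (le_trans _ logQ) // ltW.
have d3 : 0 <= d ^+ 3 by rewrite exprn_ge0.
(* 64 * (5 / 2) * 19 = 3040, and 3040 * 64 <= 600 ^ 2 *)
have -> : c * ((4 * d) ^+ 3 / (2 / 5 * e) * (19 * e))
    = c * 3040 * d ^+ 3 by field; exact: lt0r_neq0.
have := ler_wpM2r d3 c_le; rewrite exprMn; lra.
Qed.

Local Open Scope classical_set_scope.
Local Open Scope ring_scope.

Theorem theorem1p5 (R : realType) :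
  exists (kappa : R) (N : nat -> nat) (C : forall k : nat, concept_class (N k)),
    [/\ 0 < kappa,
        forall k : nat, (2 <= quantum_query_complexity R (C k))%N,
        (fun k : nat => quantum_query_complexity R (C k)) @ \oo --> \oo
      & forall k : nat,
          kappa
            * ((quantum_query_complexity R (C k))%:R ^+ 3
               / log2 (quantum_query_complexity R (C k))%:R)
            * log2 (N k)%:R
          <= (randomized_query_complexity R (C k))%:R].
Proof.
have DE k : (2 ^ (k + 5)).-1.+1 = (2 ^ (k + 5))%N by rewrite prednK // expn_gt0.
have c_gt0 : 0 < 600 ^+ 2 :> R by apply: exprn_gt0; rewrite ltr0n.
have [NC NCP] := boolp.choice (fun k => hidden_class_exists R (DE k)).
exists (600 ^+ 2)^-1, (fun k => projT1 (NC k)), (fun k => projT2 (NC k)).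
pose Q k := quantum_query_complexity R (projT2 (NC k)).
have QP k : (Q k <= (2 ^ (k + 5)).+1 + 2 ^ (k + 5))%N /\ (2 ^ (k + 5) <= 5 * Q k)%N.
  have [_ learn lower _] := NCP k; rewrite !DE in learn lower.
  have [|Qlearn Qmin] := @leastP (quantum_learnable R (projT2 (NC k))).
    by exists ((2 ^ (k + 5)).+1 + 2 ^ (k + 5))%N.
  by split; [exact: Qmin | exact: lower].
have pow32 k : (32 * 2 ^ k = 2 ^ (k + 5))%N by rewrite expnD mulnC.
have Q_ge k : (k < Q k)%N.
  have [_] := QP k; rewrite -pow32; have := ltn_expl k (isT : 1 < 2)%N; lia.
split.
- by rewrite invr_gt0; exact: c_gt0.
- move=> k; rewrite -/(Q k); have [_] := QP k; rewrite -pow32.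
  have : (0 < 2 ^ k)%N by rewrite expn_gt0. lia.
- apply/cvgnyPge => n; near=> k; rewrite -/(Q k); apply: leq_trans (ltnW (Q_ge k)).
  by near: k; exact: nbhs_infty_ge.
- move=> k; rewrite -/(Q k); have [N_le _ _ lowerR] := NCP k.
  rewrite DE in N_le; have [Q_le Q_ge'] := QP k.
  have [|Rlearn _] := @leastP (randomized_learnable R (projT2 (NC k))).
    exact: randomized_learnable_exists.
  have /ltnW Rge := lowerR _ Rlearn; rewrite -/(randomized_query_complexity R _) in Rge.
  rewrite -(ler_nat R) in Rge; apply: le_trans Rge.
  have pow_gt0 : (0 < 2 ^ k)%N by rewrite expn_gt0.
  apply: gap_arithmetic N_le.
  + by rewrite invr_ge0; exact: ltW c_gt0.
  + by rewrite (mulVf (lt0r_neq0 c_gt0)).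
  + by move: Q_ge'; rewrite -pow32 (expnD 2 k 2); clear; lia.
  + by move: Q_le pow_gt0; rewrite -pow32; clear; lia.
Unshelve. all: by end_near.
Qed.
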